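(* Let $\varphi\in\mathcal{M}_{<1}$ be a non-constant function, let $r\ge 1$, and let $P_1,P_2,\ldots,P_r\in\mathbb{C}[z]$ be non-constant polynomials of degrees $d_1,d_2,\ldots,d_r$ such that $P_j-P_k$ is non-constant for any $j\neq k$. Let $f_j(z)=e^{P_j(z)}$ for $1\le j\le r$. Then: (1) $\varphi,f_1,\ldots,f_r$ are linearly independent over $\mathbb{C}$. (2) If $|\{d_1,\ldots,d_r\}|=r$ (that is, the degrees are pairwise distinct), then $\varphi,f_1,\ldots,f_r$ are algebraically independent over $\mathbb{C}$. Moreover, if $A=(a_{ij})_{0\le i,j\le r}$ is a nonsingular matrix with entries in $\mathbb{C}$, and $$g_j=a_{0j}\varphi+a_{1j}f_1+\cdots+a_{rj}f_r\quad\text{for } 0\le j\le r,$$ then the conclusions (1) and (2) hold if we replace $\varphi,f_1,\ldots,f_r$ with $g_0,g_1,\ldots,g_r$; that is, $g_0,\ldots,g_r$ are linearly independent over $\mathbb{C}$, and if $|\{d_1,\ldots,d_r\}|=r$ then $g_0,\ldots,g_r$ are algebraically independent over $\mathbb{C}$.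
   Context: An entire function $g$ has order of growth $\le\rho$ (for a real number $\rho>0$) if there are constants $A,B>0$ such that $|g(z)|\le Ae^{B|z|^{\rho}}$ for all $z\in\mathbb{C}$; its order of growth is $\rho(g)=\inf\{\rho>0 : g \text{ has order of growth}\le\rho\}$. $\mathcal{O}_{<1}$ denotes the domain of entire functions with order of growth $<1$, and $\mathcal{M}_{<1}$ denotes its quotient field, i.e. the field of meromorphic functions on $\mathbb{C}$ of order $<1$, viewed as a subfield of the field of all meromorphic functions on $\mathbb{C}$. *)

(* Defs.v *)
From HB Require Import structures.
From mathcomp Require Import all_boot all_order all_algebra.
From mathcomp Require Import all_classical all_reals all_analysis.
From mathcomp Require Export complex.
(* The notations of mpoly clash with those of the analysis library. *)
From mathcomp Require Export -(notations) mpoly.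

Set Implicit Arguments.
Unset Strict Implicit.
Unset Printing Implicit Defensive.

Import Order.TTheory GRing.Theory Num.Theory.
Import numFieldNormedType.Exports.

Local Open Scope classical_set_scope.
Local Open Scope complex_scope.
Local Open Scope ring_scope.

(* The field of complex numbers is R[i].  Its topology, and complex
   differentiability ([derivable f z 1], where the increment ranges over R[i]),
   come from R[i]^o, i.e. R[i] as a normed module over itself. *)

(* `|z| itself lives in R[i]. *)
Definition cmod (R : realType) (z : R[i]) : R := Normc.normc z.

Definition cexp (R : realType) (z : R[i]) : R[i] :=
  let: x +i* y := z in (expR x)%:C * (cos y +i* sin y).

Definition holomorphic_at (R : realType) (f : R[i] -> R[i]) (z : R[i]) : Prop :=
  \forall w \near (z : R[i]^o), derivable (f : R[i]^o -> R[i]^o) w 1.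

Definition entire (R : realType) (f : R[i] -> R[i]) : Prop :=
  forall z : R[i], derivable (f : R[i]^o -> R[i]^o) z 1.

Definition has_order_le (R : realType) (g : R[i] -> R[i]) (rho : R) : Prop :=
  exists A B : R, [/\ 0 < A, 0 < B &
    forall z : R[i], cmod (g z) <= A * expR (B * (cmod z `^ rho))].

(* +oo when g is of infinite order *)
Definition growth_order (R : realType) (g : R[i] -> R[i]) : \bar R :=
  ereal_inf [set rho%:E | rho in [set rho : R | 0 < rho /\ has_order_le g rho]].

Definition O_lt1 (R : realType) : set (R[i] -> R[i]) :=
  [set g | entire g /\ (growth_order g < 1%:E)%E].

(* A meromorphic function is represented by a total function on R[i]; its
   values at the points of a closed discrete set (in particular at the poles)
   are irrelevant, equality of meromorphic functions being [mer_eq]. *)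
Definition meromorphic (R : realType) (f : R[i] -> R[i]) : Prop :=
  forall z : R[i], exists (n : nat) (u : R[i] -> R[i]),
    holomorphic_at u z /\
    \forall w \near (z : R[i]^o)^', (w - z) ^+ n * f w = u w.

(* Equality outside a set without accumulation points. *)
Definition mer_eq (R : realType) (f g : R[i] -> R[i]) : Prop :=
  forall z : R[i], \forall w \near (z : R[i]^o)^', f w = g w.

(* The quotient field of O_lt1 inside the field of meromorphic functions: the
   fractions g / h with g, h in O_lt1 and h not the zero function. *)
Definition M_lt1 (R : realType) : set (R[i] -> R[i]) :=
  [set f | meromorphic f /\
    exists g h : R[i] -> R[i], [/\ O_lt1 g, O_lt1 h, exists z, h z != 0 &
      mer_eq f (fun z => g z / h z)]].

Definition mer_nonconstant (R : realType) (f : R[i] -> R[i]) : Prop :=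
  ~ exists c : R[i], mer_eq f (fun _ => c).

Definition lin_indep (R : realType) (n : nat) (f : 'I_n -> R[i] -> R[i]) : Prop :=
  forall c : 'I_n -> R[i],
    mer_eq (fun z => \sum_(i < n) c i * f i z) (fun _ => 0) ->
    forall i, c i = 0.

Definition alg_indep (R : realType) (n : nat) (f : 'I_n -> R[i] -> R[i]) : Prop :=
  forall p : mpoly n R[i],
    mer_eq (fun z => meval (fun i => f i z) p) (fun _ => 0) -> p = 0.

Definition pdeg (K : nzRingType) (p : {poly K}) : nat := (size p).-1.

Definition nonconstant_poly (K : nzRingType) (p : {poly K}) : Prop :=
  (0 < pdeg p)%N.

(* The family phi, exp(P_1), ..., exp(P_r), with phi at index 0 and exp(P_j)
   at index j (here P is indexed from 0, so P j sits at index j.+1). *)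
Definition exp_family (R : realType) (r : nat) (phi : R[i] -> R[i])
    (P : 'I_r -> {poly R[i]}) (i : 'I_r.+1) : R[i] -> R[i] :=
  if unlift ord0 i is Some j then fun z => cexp (P j).[z] else phi.

(* The coefficients of the j-th combination are the j-th column of A. *)
Definition mix_family (R : realType) (n : nat) (A : 'M[R[i]]_n)
    (f : 'I_n -> R[i] -> R[i]) (j : 'I_n) : R[i] -> R[i] :=
  fun z => \sum_(i < n) A i j * f i z.

(* Main.v *)
Require Import Defs.
From mathcomp Require Import all_boot all_order all_algebra.
From mathcomp Require Import all_classical all_reals all_analysis.
From mathcomp Require Import ring lra.

(** The proof rests on a form of Borel's theorem ([borel]): if the entire
    functions H_i grow more slowly than exp (e |z|) for every e > 0, the
    polynomials Q_i have pairwise nonconstant differences, and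
    sum_i H_i exp(Q_i) = 0, then every H_i is zero.

    Discard the H_i that vanish identically.  Along all but finitely many
    directions u the real parts of the remaining Q_i are asymptotically
    distinct, so one exponential, say exp(Q_k), dominates all the others
    ([exists_direction], [decays_ray]).  Dividing by it gives
    |H_k(a + r v)| <= C exp(-e r) for v in a small arc of the unit circle
    around u and r large, while |H_k| is subexponential everywhere.  Rotate
    this arc until it covers the circle: the product over j of the functions
    f(a + rho_j w), with f = H_k and finitely many unit numbers rho_j, is
    exponentially small on the whole circle |w| = r because at each point one
    factor is.  By the maximum principle its value at 0, a power of H_k(a), is
    then arbitrarily small ([arc_bound]).  So H_k(a) = 0 for every a, which is
    absurd.

    Only one fact of complex analysis is used: the value of a complex
    differentiable function at the centre of a disk is bounded by its supremum
    on the boundary circle ([cmod_center_le]).  It follows from the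
    Cauchy-Goursat theorem for the rectangle [x, 0] * [0, 2 pi] and the
    function F(r exp(z)), which is 2 pi i-periodic: the horizontal sides cancel,
    so the mean of F over a circle around 0 does not depend on its radius, and
    it tends to F(0) when the radius shrinks.  The same rotation argument also
    gives the identity principle: a function which vanishes near b vanishes at
    the centre of each disk of the domain whose boundary passes through b
    ([zero_propagates]).

    Let phi = g / h with g and h entire of order < 1.  A relation
    sum_i q_i(phi) exp(Q_i) = 0 with polynomial coefficients q_i becomes, after
    multiplication by a power of h, a relation of the kind above, whence
    h^(N+1) q_i(g / h) = 0.  If some q_i were nonzero, then near a point where
    h does not vanish g / h would be a root of q_i, hence locally constant, and
    phi would be constant by the identity principle
    ([low_order_coefficients]).  Linear independence is the case where the
    exponents are 0, P_1, ..., P_r.  For algebraic independence, group the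
    monomials of a polynomial relation by their exponents t_1, ..., t_r in the
    exponentials; the exponents sum_j t_j P_j have pairwise nonconstant
    differences because the P_j have distinct positive degrees.  Finally, an
    invertible linear substitution preserves both kinds of independence. *)

Set Implicit Arguments.
Unset Strict Implicit.
Unset Printing Implicit Defensive.

Import Order.TTheory GRing.Theory Num.Theory.
Import numFieldNormedType.Exports.

Local Open Scope classical_set_scope.
Local Open Scope complex_scope.
Local Open Scope ring_scope.

(** * Integration around rectangles *)

Section Goursat.
Variable R : realType.
Implicit Types (f g : R -> R) (a b c d x y : R).

Definition segint f a b : R := \int[@lebesgue_measure R]_(x in `[a, b]) f x.

Lemma continuous_segment_integrable f a b : {in `[a, b], continuous f} ->
  (@lebesgue_measure R).-integrable `[a, b] (EFin \o f).
Proof.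
move=> cf; apply: continuous_compact_integrable; first exact: segment_compact.
by apply: continuous_in_subspaceT => x /set_mem; exact: cf.
Qed.

Lemma segint_cat f a m b : a <= m -> m <= b -> {in `[a, b], continuous f} ->
  segint f a b = segint f a m + segint f m b.
Proof.
move=> am mb cf; rewrite /segint.
have := @Rintegral_itvB R f (BLeft a) (BRight b) m (continuous_segment_integrable cf).
rewrite !bnd_simp => /(_ am mb) => E.
rewrite -[LHS](subrK (\int[@lebesgue_measure R]_(t in `[a, m]) f t)) addrC; congr +%R.
rewrite E Rintegral_itv_obnd_cbnd//.
apply: (integrableS _ _ _ (continuous_segment_integrable cf)) => //.
by apply: subset_itvr; rewrite bnd_simp.
Qed.

Lemma segintD f g a b : {in `[a, b], continuous f} -> {in `[a, b], continuous g} ->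
  segint (fun x => f x + g x) a b = segint f a b + segint g a b.
Proof. by move=> cf cg; rewrite /segint RintegralD//; exact: continuous_segment_integrable. Qed.

Lemma segint_cst k a b : a <= b -> segint (fun=> k) a b = k * (b - a).
Proof.
move=> ab; rewrite /segint Rintegral_cst//= lebesgue_measure_itv/=.
case: ltP => //; rewrite lee_fin => ba; have -> : b = a by apply/le_anti/andP; split.
by rewrite subrr.
Qed.

Lemma segint_near_cst f k M a b : a <= b -> {in `[a, b], continuous f} ->
  (forall x, a <= x <= b -> `|f x - k| <= M) ->
  `|segint f a b - k * (b - a)| <= M * (b - a).
Proof.
move=> ab cf fM.
have ci : {in `[a, b], continuous (fun=> k : R)} by move=> x _; exact: cvg_cst.
have cM : {in `[a, b], continuous (fun=> M : R)} by move=> x _; exact: cvg_cst.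
have cg : {in `[a, b], continuous (fun x => f x - k)}.
  by move=> x xab; apply: cvgB; [exact: cf|exact: cvg_cst].
have cn : {in `[a, b], continuous (fun x => `|f x - k|)}.
  by move=> x xab; apply: cvg_norm; exact: cg.
rewrite -segint_cst// -[X in _ <= X]segint_cst// /segint -RintegralB//;
  try exact: continuous_segment_integrable.
apply: (le_trans (le_normr_Rintegral _ (continuous_segment_integrable cg))) => //.
by apply: le_Rintegral => //; exact: continuous_segment_integrable.
Qed.

(** Nested intervals: at each step either the left or the right half of the
    previous interval is kept. *)
Lemma bisection_sequence (l0 : R) (x : nat -> R) : 0 <= l0 ->
  (forall n, x n.+1 = x n \/ x n.+1 = x n + l0 / 2 ^+ n.+1) ->
  exists p, forall n, x n <= p <= x n + l0 / 2 ^+ n.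
Proof.
move=> l00 xS.
have lS n : l0 / 2 ^+ n = l0 / 2 ^+ n.+1 + l0 / 2 ^+ n.+1.
  by rewrite exprS invfM; lra.
have lp n : 0 <= l0 / 2 ^+ n by rewrite divr_ge0// exprn_ge0.
have up n k : x n <= x (n + k)%N.
  elim: k => [|k IH]; first by rewrite addn0.
  rewrite addnS; apply: (le_trans IH); have := lp (n + k).+1.
  by case: (xS (n + k)%N) => ->; lra.
have dn n k : x (n + k)%N + l0 / 2 ^+ (n + k) <= x n + l0 / 2 ^+ n.
  elim: k => [|k IH]; first by rewrite addn0.
  rewrite addnS; apply: le_trans IH; rewrite (lS (n + k)%N); have := lp (n + k).+1.
  by case: (xS (n + k)%N) => ->; lra.
have xle n k : x k <= x n + l0 / 2 ^+ n.
  case: (leqP n k) => [nk|/ltnW kn].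
    by have := dn n (k - n)%N; rewrite subnKC// => h; have := lp k; lra.
  have := up k (n - k)%N; rewrite subnKC// => h; have := lp n; lra.
exists (sup (range x)) => n.
have ubx k : ubound (range x) (x k + l0 / 2 ^+ k) by move=> _ [j _ <-].
apply/andP; split.
  apply: ub_le_sup; last by exists n.
  by exists (x n + l0 / 2 ^+ n).
by apply: ge_sup => //; exists (x 0%N), 0%N.
Qed.

Lemma quarter_norm_ge (A B C D : R) :
  [\/ `|A + B + (C + D)| <= 4 * `|A|, `|A + B + (C + D)| <= 4 * `|B|,
      `|A + B + (C + D)| <= 4 * `|C| | `|A + B + (C + D)| <= 4 * `|D|].
Proof.
have N : `|A + B + (C + D)| <= `|A| + `|B| + (`|C| + `|D|).
  by rewrite (le_trans (ler_normD _ _))// lerD// ler_normD.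
have [hA|hA] := leP `|A + B + (C + D)| (4 * `|A|); first by constructor 1.
have [hB|hB] := leP `|A + B + (C + D)| (4 * `|B|); first by constructor 2.
have [hC|hC] := leP `|A + B + (C + D)| (4 * `|C|); first by constructor 3.
constructor 4; lra.
Qed.

(** The argument of Goursat: [Phi a b c d], a function of the rectangle
    [a, b] * [c, d], is additive under subdivision and o(size ^ 2) at each
    point.  Quartering keeps at least a quarter of its absolute value in one of
    the four pieces, while the smallness at the limit point of the pieces says
    that it decreases faster than 4 ^ (- n). *)
Lemma rectangle_additive_eq0 (Phi : R -> R -> R -> R -> R) a b c d :
  a <= b -> c <= d ->
  (forall a1 m1 b1 c1 d1, a <= a1 -> a1 <= m1 -> m1 <= b1 -> b1 <= b ->
     c <= c1 -> c1 <= d1 -> d1 <= d ->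
     Phi a1 b1 c1 d1 = Phi a1 m1 c1 d1 + Phi m1 b1 c1 d1) ->
  (forall a1 b1 c1 m1 d1, a <= a1 -> a1 <= b1 -> b1 <= b ->
     c <= c1 -> c1 <= m1 -> m1 <= d1 -> d1 <= d ->
     Phi a1 b1 c1 d1 = Phi a1 b1 c1 m1 + Phi a1 b1 m1 d1) ->
  (forall p q e, a <= p <= b -> c <= q <= d -> 0 < e -> exists2 dl, 0 < dl &
     forall a1 b1 c1 d1, a <= a1 -> a1 <= p <= b1 -> b1 <= b ->
       c <= c1 -> c1 <= q <= d1 -> d1 <= d -> (b1 - a1) + (d1 - c1) < dl ->
       `|Phi a1 b1 c1 d1| <= e * ((b1 - a1) + (d1 - c1)) ^+ 2) ->
  Phi a b c d = 0.
Proof.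
move=> ab cd splitx splity small.
set l := b - a; set m := d - c.
have l0 : 0 <= l by rewrite /l; lra.
have m0 : 0 <= m by rewrite /m; lra.
have hl n (z : R) : z / 2 ^+ n = z / 2 ^+ n.+1 + z / 2 ^+ n.+1.
  by rewrite exprS invfM; lra.
have hp n (z : R) : 0 <= z -> 0 <= z / 2 ^+ n by move=> z0; rewrite divr_ge0// exprn_ge0.
pose Psi n (s : R * R) := Phi s.1 (s.1 + l / 2 ^+ n) s.2 (s.2 + m / 2 ^+ n).
pose inr n (s : R * R) := [/\ a <= s.1, s.1 + l / 2 ^+ n <= b, c <= s.2 &
   s.2 + m / 2 ^+ n <= d].
have step n s : exists s', inr n s -> [/\ (s'.1 = s.1 \/ s'.1 = s.1 + l / 2 ^+ n.+1),
   (s'.2 = s.2 \/ s'.2 = s.2 + m / 2 ^+ n.+1), inr n.+1 s' &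
   `|Psi n s| <= 4 * `|Psi n.+1 s'|].
  case: (pselect (inr n s)) => [|h]; last by exists s => /h.
  case: s => x y [/= h1 h2 h3 h4].
  have [lh0 mh0] := (hp n.+1 l l0, hp n.+1 m m0).
  have [s' [h1' h2' h3']] : exists s' : R * R, [/\ (s'.1 = x \/ s'.1 = x + l / 2 ^+ n.+1),
     (s'.2 = y \/ s'.2 = y + m / 2 ^+ n.+1) & `|Psi n (x, y)| <= 4 * `|Psi n.+1 s'|].
    rewrite {}/Psi {inr}/= (hl n l) (hl n m); rewrite (hl n l) in h2; rewrite (hl n m) in h4.
    move: (l / 2 ^+ n.+1) (m / 2 ^+ n.+1) lh0 mh0 h2 h4 => lh mh lh0 mh0 h2 h4.
    clear -splitx splity lh0 mh0 h1 h2 h3 h4.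
    have E : Phi x (x + (lh + lh)) y (y + (mh + mh)) =
        Phi x (x + lh) y (y + mh) + Phi x (x + lh) (y + mh) (y + mh + mh) +
        (Phi (x + lh) (x + lh + lh) y (y + mh) +
         Phi (x + lh) (x + lh + lh) (y + mh) (y + mh + mh)).
      rewrite !addrA in h2 h4 *.
      rewrite (splitx _ (x + lh)); [|lra..].
      rewrite (splity x (x + lh) y (y + mh)); [|lra..].
      by rewrite (splity (x + lh) _ y (y + mh)) ?addrA; [|lra..].
    rewrite E.
    have [H|H|H|H] := quarter_norm_ge (Phi x (x + lh) y (y + mh))
        (Phi x (x + lh) (y + mh) (y + mh + mh)) (Phi (x + lh) (x + lh + lh) y (y + mh))
        (Phi (x + lh) (x + lh + lh) (y + mh) (y + mh + mh)).
    - by exists (x, y); split => //; left.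
    - by exists (x, y + mh); split => //; [left|right].
    - by exists (x + lh, y); split => //; [right|left].
    - by exists (x + lh, y + mh); split => //; right.
  exists s' => _; split => //.
  rewrite (hl n l) in h2; rewrite (hl n m) in h4.
  rewrite /inr; clear -lh0 mh0 h1 h2 h3 h4 h1' h2'.
  by case: h1' => ->; case: h2' => ->; split; lra.
have /boolp.choice[st stP] : forall ns : nat * (R * R), exists s', inr ns.1 ns.2 ->
   [/\ (s'.1 = ns.2.1 \/ s'.1 = ns.2.1 + l / 2 ^+ ns.1.+1),
   (s'.2 = ns.2.2 \/ s'.2 = ns.2.2 + m / 2 ^+ ns.1.+1), inr ns.1.+1 s' &
   `|Psi ns.1 ns.2| <= 4 * `|Psi ns.1.+1 s'|].
  by move=> [n s]; exact: step.
pose s := fix s n := if n is k.+1 then st (k, s k) else (a, c).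
have sin n : inr n (s n).
  elim: n => [|n IH]; last by have [] := stP (n, s n) IH.
  by rewrite /inr/= !expr0 !divr1 /l /m !subrKC; split.
have [p pP] : exists p, forall n, (s n).1 <= p <= (s n).1 + l / 2 ^+ n.
  by apply: bisection_sequence => // n; have [] := stP (n, s n) (sin n).
have [q qP] : exists q, forall n, (s n).2 <= q <= (s n).2 + m / 2 ^+ n.
  by apply: bisection_sequence => // n; have [] := stP (n, s n) (sin n).
have big n : `|Phi a b c d| <= 4 ^+ n * `|Psi n (s n)|.
  elim: n => [|n IH].
    by rewrite expr0 mul1r /Psi/= !expr0 !divr1 /l /m !subrKC.
  apply: (le_trans IH); rewrite exprSr -mulrA ler_pM2l ?exprn_gt0//.
  by have [] := stP (n, s n) (sin n).
apply/eqP; rewrite -normr_eq0; apply/eqP/le_anti/andP; split => //.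
apply/ler_addgt0Pl => e e0; rewrite addr0.
set K := (l + m) ^+ 2 + 1.
have K0 : 0 < K by rewrite ltr_wpDl// sqr_ge0.
have [pab qcd] : a <= p <= b /\ c <= q <= d.
  have [/andP[p1 p2] /andP[q1 q2]] := (pP 0%N, qP 0%N); have [s1 s2 s3 s4] := sin 0%N.
  split; apply/andP; split.
  - exact: p1.
  - exact: le_trans p2 s2.
  - exact: q1.
  - exact: le_trans q2 s4.
have [dl dl0 H] := small p q (e / K) pab qcd (divr_gt0 e0 K0).
have [n nP] : exists n, (l + m) / 2 ^+ n < dl.
  have [n nP] : exists n : nat, (l + m) / dl < n%:R.
    exists (Num.bound ((l + m) / dl)); apply: archi_boundP.
    exact: divr_ge0 (addr_ge0 l0 m0) (ltW dl0).
  exists n; rewrite ltr_pdivrMr ?exprn_gt0// mulrC -ltr_pdivrMr//.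
  apply: (lt_le_trans nP); rewrite -natrX ler_nat; exact/ltnW/ltn_expl.
have [i1 i2 i3 i4] := sin n.
apply: (le_trans (big n)).
have dE : (s n).1 + l / 2 ^+ n - (s n).1 + ((s n).2 + m / 2 ^+ n - (s n).2) = (l + m) / 2 ^+ n.
  by rewrite [in RHS]mulrDl; move: (l / _) (m / _) => X Y; ring.
have := H _ _ _ _ i1 (pP n) i2 i3 (qP n) i4; rewrite dE => /(_ nP) h.
rewrite -/(Psi n (s n)) in h; apply: (le_trans (ler_wpM2l _ h)); first by rewrite exprn_ge0.
have -> : 4 ^+ n * (e / K * ((l + m) / 2 ^+ n) ^+ 2) = e * ((l + m) ^+ 2 / K).
  have -> : (4 : R) ^+ n = (2 ^+ n) ^+ 2 by rewrite -exprM mulnC exprM; congr (_ ^+ _); ring.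
  by field; rewrite lt0r_neq0//= expf_neq0.
by rewrite -[X in _ <= X]mulr1 ler_pM2l// ler_pdivrMr// mul1r /K lerDl ler01.
Qed.

Definition has_gradient (u : R -> R -> R) (al be : R) (p q : R) :=
  forall e, 0 < e -> exists2 dl, 0 < dl & forall x y, `|x - p| + `|y - q| < dl ->
    `|u x y - u p q - al * (x - p) - be * (y - q)| <= e * (`|x - p| + `|y - q|).

Lemma has_gradient_continuous u al be p q : has_gradient u al be p q ->
  forall e, 0 < e -> exists2 dl, 0 < dl & forall x y, `|x - p| + `|y - q| < dl ->
    `|u x y - u p q| < e.
Proof.
move=> hu e e0; have [dl dl0 H] := hu 1 ltr01.
set K := `|al| + `|be| + 1.
have K0 : 0 < K by rewrite /K; have := normr_ge0 al; have := normr_ge0 be; lra.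
exists (Num.min dl (e / K)); first by rewrite lt_min dl0 divr_gt0.
move=> x y; rewrite lt_min => /andP[/H h1 h2].
rewrite ltr_pdivlMr// in h2; apply: le_lt_trans h2.
have -> : u x y - u p q = (u x y - u p q - al * (x - p) - be * (y - q)) +
   (al * (x - p) + be * (y - q)) by ring.
apply: (le_trans (ler_normD _ _)).
have : `|al * (x - p) + be * (y - q)| <= `|al| * `|x - p| + `|be| * `|y - q|.
  by rewrite (le_trans (ler_normD _ _))// !normrM.
have := normr_ge0 al; have := normr_ge0 be; have := normr_ge0 (x - p).
have := normr_ge0 (y - q); rewrite /K; nra.
Qed.

Lemma has_gradient_continuousl u al be p q : has_gradient u al be p q ->
  {for p, continuous (fun x => u x q)}.
Proof.
move=> /has_gradient_continuous hu; apply/cvgrPdist_lt => e e0.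
have [dl dl0 H] := hu e e0; near=> x; rewrite distrC; apply: H.
rewrite subrr normr0 addr0 distrC; near: x.
exact: (@nbhsx_ballx R R _ _ dl0).
Unshelve. all: end_near. Qed.

Lemma has_gradient_continuousr u al be p q : has_gradient u al be p q ->
  {for q, continuous (fun y => u p y)}.
Proof.
move=> /has_gradient_continuous hu; apply/cvgrPdist_lt => e e0.
have [dl dl0 H] := hu e e0; near=> x; rewrite distrC; apply: H.
rewrite subrr normr0 add0r distrC; near: x.
exact: (@nbhsx_ballx R R _ _ dl0).
Unshelve. all: end_near. Qed.

Lemma rectangle_defect_le (u v : R -> R -> R) a b c d p q al be ga k :
  a <= p <= b -> c <= q <= d ->
  (forall x y, a <= x <= b -> c <= y <= d -> {for y, continuous (fun y => u x y)}) ->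
  (forall x y, a <= x <= b -> c <= y <= d -> {for x, continuous (fun x => v x y)}) ->
  (forall x y, a <= x <= b -> c <= y <= d ->
    `|u x y - u p q - al * (x - p) - be * (y - q)| <= k) ->
  (forall x y, a <= x <= b -> c <= y <= d ->
    `|v x y - v p q - ga * (x - p) - al * (y - q)| <= k) ->
  `|segint (fun y => u b y - u a y) c d - segint (fun x => v x d - v x c) a b| <=
    2 * k * (b - a + (d - c)).
Proof.
move=> /andP[ap pb] /andP[cq qd] cu cv hu hv.
have ab : a <= b by exact: le_trans pb.
have cd : c <= d by exact: le_trans qd.
have [ma mb] : a <= a <= b /\ a <= b <= b by rewrite !lexx ab.
have [mc md] : c <= c <= d /\ c <= d <= d by rewrite !lexx cd.
have cU : {in `[c, d], continuous (fun y => u b y - u a y)}.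
  by move=> y; rewrite in_itv/= => hy; apply: cvgB; exact: cu.
have cV : {in `[a, b], continuous (fun x => v x d - v x c)}.
  by move=> x; rewrite in_itv/= => hx; apply: cvgB; exact: cv.
have Eu y : c <= y <= d -> `|u b y - u a y - al * (b - a)| <= k + k.
  move=> hy; apply: le_trans (lerD (hu b y mb hy) (hu a y ma hy)).
  apply: le_trans (ler_normB _ _); rewrite le_eqVlt; apply/orP; left.
  by apply/eqP; congr `|_|; ring.
have Ev x : a <= x <= b -> `|v x d - v x c - al * (d - c)| <= k + k.
  move=> hx; apply: le_trans (lerD (hv x d hx md) (hv x c hx mc)).
  apply: le_trans (ler_normB _ _); rewrite le_eqVlt; apply/orP; left.
  by apply/eqP; congr `|_|; ring.
have -> : 2 * k * (b - a + (d - c)) = (k + k) * (d - c) + (k + k) * (b - a) by ring.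
apply: le_trans (lerD (segint_near_cst cd cU Eu) (segint_near_cst ab cV Ev)).
apply: le_trans (ler_normB _ _); rewrite le_eqVlt; apply/orP; left.
by apply/eqP; congr `|_|; ring.
Qed.

(** The flux of (u, - v) through the boundary of a rectangle vanishes when
    u_x = v_y.  Differentiability at each point suffices: u and v are linear up
    to o(size), so that [rectangle_defect_le] bounds the flux by o(size ^ 2). *)
Lemma divergence_free_rectangle (u v : R -> R -> R) a b c d : a <= b -> c <= d ->
  (forall p q, a <= p <= b -> c <= q <= d -> exists al be ga : R,
     has_gradient u al be p q /\ has_gradient v ga al p q) ->
  segint (fun y => u b y - u a y) c d = segint (fun x => v x d - v x c) a b.
Proof.
move=> ab cd hD.
have cu x y : a <= x <= b -> c <= y <= d -> {for y, continuous (fun y => u x y)}.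
  by move=> hx hy; have [al [be [ga [h _]]]] := hD x y hx hy; exact: has_gradient_continuousr h.
have cv x y : a <= x <= b -> c <= y <= d -> {for x, continuous (fun x => v x y)}.
  by move=> hx hy; have [al [be [ga [_ h]]]] := hD x y hx hy; exact: has_gradient_continuousl h.
have cU x1 x2 c1 d1 : a <= x1 <= b -> a <= x2 <= b -> c <= c1 -> d1 <= d ->
    {in `[c1, d1], continuous (fun y => u x1 y - u x2 y)}.
  by move=> h1 h2 h3 h4 y; rewrite in_itv/= => hy; apply: cvgB; apply: cu => //; lra.
have cV y1 y2 a1 b1 : c <= y1 <= d -> c <= y2 <= d -> a <= a1 -> b1 <= b ->
    {in `[a1, b1], continuous (fun x => v x y1 - v x y2)}.
  by move=> h1 h2 h3 h4 x; rewrite in_itv/= => hx; apply: cvgB; apply: cv => //; lra.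
pose Phi a b c d := segint (fun y => u b y - u a y) c d - segint (fun x => v x d - v x c) a b.
apply/eqP; rewrite -subr_eq0 -/(Phi a b c d); apply/eqP.
apply: (rectangle_additive_eq0 ab cd).
- move=> a1 m1 b1 c1 d1 h1 h2 h3 h4 h5 h6 h7; rewrite /Phi.
  rewrite (@segint_cat (fun x => v x d1 - v x c1) a1 m1 b1)//; last by apply: cV; lra.
  have -> : (fun y => u b1 y - u a1 y) = (fun y => (u m1 y - u a1 y) + (u b1 y - u m1 y)).
    by apply/funext => y; ring.
  rewrite (segintD (f := fun y => u m1 y - u a1 y)); [ring|apply: cU; lra|apply: cU; lra].
- move=> a1 b1 c1 m1 d1 h1 h2 h3 h4 h5 h6 h7; rewrite /Phi.
  rewrite (@segint_cat (fun y => u b1 y - u a1 y) c1 m1 d1)//; last by apply: cU; lra.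
  have -> : (fun x => v x d1 - v x c1) = (fun x => (v x m1 - v x c1) + (v x d1 - v x m1)).
    by apply/funext => y; ring.
  rewrite (segintD (f := fun x => v x m1 - v x c1)); [ring|apply: cV; lra|apply: cV; lra].
move=> p q e hp hq e0; have [al [be [ga [hu hv]]]] := hD p q hp hq.
have e20 : 0 < e / 2 by rewrite divr_gt0.
have [d1 d10 H1] := hu _ e20; have [d2 d20 H2] := hv _ e20.
exists (Num.min d1 d2); first by rewrite lt_min d10.
move=> a1 b1 c1 e1 aa1 hp1 bb1 cc1 hq1 dd1.
set s := b1 - a1 + _; rewrite lt_min => /andP[sd1 sd2].
have dist x y : a1 <= x <= b1 -> c1 <= y <= e1 -> `|x - p| + `|y - q| <= s.
  move=> hx hy; rewrite /s; clear -hp1 hq1 hx hy.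
  by apply: lerD; rewrite ler_norml; lra.
have sub x y : a1 <= x <= b1 -> c1 <= y <= e1 -> a <= x <= b /\ c <= y <= d.
  move=> /andP[ax xb] /andP[cy ye]; split; apply/andP; split.
  - exact: le_trans ax.
  - exact: le_trans bb1.
  - exact: le_trans cy.
  - exact: le_trans dd1.
have -> : e * s ^+ 2 = 2 * (e / 2 * s) * s by rewrite expr2; clear; lra.
apply: (@rectangle_defect_le _ _ _ _ _ _ p q al be ga (e / 2 * s)) => //.
- by move=> x y hx hy; have [hx' hy'] := sub x y hx hy; exact: cu.
- by move=> x y hx hy; have [hx' hy'] := sub x y hx hy; exact: cv.
- move=> x y hx hy; have le_s := dist x y hx hy.
  by apply: le_trans (H1 x y (le_lt_trans le_s sd1)) _; rewrite ler_pM2l.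
- move=> x y hx hy; have le_s := dist x y hx hy.
  by apply: le_trans (H2 x y (le_lt_trans le_s sd2)) _; rewrite ler_pM2l.
Qed.

End Goursat.

(** * The modulus and complex neighbourhoods *)

Section Modulus.
Variable R : realType.
Implicit Types (z w : R[i]) (x y : R).

Lemma normC_cmod z : `|z| = (cmod z)%:C. Proof. by []. Qed.
Lemma cmod_ge0 z : 0 <= cmod z. Proof. by rewrite -ler0c -normC_cmod. Qed.
Lemma cmodM z w : cmod (z * w) = cmod z * cmod w. Proof. exact: Normc.normcM. Qed.
Lemma cmod0 : cmod (0 : R[i]) = 0. Proof. exact: Normc.normc0. Qed.
Lemma cmod1 : cmod (1 : R[i]) = 1. Proof. exact: Normc.normc1. Qed.
Lemma cmodN z : cmod (- z) = cmod z. Proof. exact: normcN. Qed.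
Lemma cmodD z w : cmod (z + w) <= cmod z + cmod w. Proof. exact: le_normcD. Qed.
Lemma cmodB z w : cmod (z - w) <= cmod z + cmod w.
Proof. by rewrite -(cmodN w) cmodD. Qed.
Lemma cmodC z w : cmod (z - w) = cmod (w - z).
Proof. by rewrite -cmodN opprB. Qed.
Lemma cmodR x : cmod x%:C = `|x|.
Proof. by rewrite /cmod /= expr0n/= addr0 sqrtr_sqr. Qed.
Lemma cmod_eq0 z : (cmod z == 0) = (z == 0).
Proof. by apply/eqP/eqP => [/Normc.eq0_normc//|->]; exact: cmod0. Qed.
Lemma cmod_gt0 z : (0 < cmod z) = (z != 0).
Proof. by rewrite lt0r cmod_ge0 andbT cmod_eq0. Qed.
Lemma cmodX z n : cmod (z ^+ n) = cmod z ^+ n.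
Proof. by elim: n => [|n IH]; rewrite ?expr0 ?cmod1// !exprS cmodM IH. Qed.
Lemma cmod_prod (I : Type) (r : seq I) (P : pred I) (F : I -> R[i]) :
  cmod (\prod_(i <- r | P i) F i) = \prod_(i <- r | P i) cmod (F i).
Proof. exact: (big_morph _ cmodM cmod1). Qed.
Lemma cmod_sum (I : Type) (r : seq I) (P : pred I) (F : I -> R[i]) :
  cmod (\sum_(i <- r | P i) F i) <= \sum_(i <- r | P i) cmod (F i).
Proof.
elim/big_rec2: _ => [|i x y _ h]; first by rewrite cmod0.
by rewrite (le_trans (cmodD _ _))// lerD2l.
Qed.
Lemma ger_Re_cmod z : `|complex.Re z| <= cmod z.
Proof. by rewrite -lecR; exact: normc_ge_Re. Qed.
Lemma cmod_conj z : cmod z^*%C = cmod z.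
Proof. by case: z => x y; rewrite /cmod/= sqrrN. Qed.
Lemma ger_Im_cmod z : `|complex.Im z| <= cmod z.
Proof.
case: z => x y; rewrite /cmod/= -sqrtr_sqr ler_sqrt//.
  by rewrite ler_wpDl// sqr_ge0.
by rewrite addr_ge0// sqr_ge0.
Qed.
Lemma cmod_le_ReIm z : cmod z <= `|complex.Re z| + `|complex.Im z|.
Proof.
case: z => x y; rewrite [complex.Re _]/= [complex.Im _]/=.
have -> : x +i* y = x%:C + 'i * y%:C by simpc.
rewrite (le_trans (cmodD _ _))// cmodM !cmodR lerD2l.
by rewrite /cmod/= expr0n/= add0r expr1n sqrtr1 mul1r.
Qed.
Lemma conjM_cmod z : z^*%C * z = (cmod z ^+ 2)%:C.
Proof.
case: z => x y; rewrite /cmod/= sqr_sqrtr; last by rewrite addr_ge0// sqr_ge0.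
by simpc; congr (_ +i* _); ring.
Qed.

Lemma nbhsC_P z (P : set R[i]) :
  (\forall w \near (z : R[i]^o), P w) <->
  exists2 d : R, 0 < d & forall w, cmod (w - z) < d -> P w.
Proof.
split.
  move/nbhs_ballP => -[e /= e0 H].
  have eE : e = (complex.Re e)%:C by rewrite RRe_real// gtr0_real.
  exists (complex.Re e); first by rewrite -ltcR -eE.
  by move=> w h; apply: H; rewrite /ball /= /ball_ distrC eE normC_cmod ltcR.
move=> [d d0 H]; apply/nbhs_ballP; exists d%:C => //=; first by rewrite ltcR.
by move=> w; rewrite /ball/= /ball_ distrC => h; apply: H; rewrite -ltcR.
Qed.

Lemma dnbhsC_P z (P : set R[i]) :
  (\forall w \near (z : R[i]^o)^', P w) <->
  exists2 d : R, 0 < d & forall w, w != z -> cmod (w - z) < d -> P w.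
Proof.
rewrite /dnbhs near_withinE; split.
  by move=> /nbhsC_P[d d0 H]; exists d => // w h1 h2; exact: H.
by move=> [d d0 H]; apply/nbhsC_P; exists d => // w h2 h1; exact: H.
Qed.
End Modulus.

(** * Complex differentiability *)

Section Caratheodory.
Variable R : realType.
Implicit Types (f g : R[i] -> R[i]) (z w : R[i]).

(** Continuity at a point in terms of the real-valued modulus, which avoids
    the two structures (ring and normed module over itself) on R[i]. *)
Definition ccont f z := forall e : R, 0 < e ->
  exists2 d : R, 0 < d & forall w, cmod (w - z) < d -> cmod (f w - f z) < e.

Lemma ccont_cst k z : ccont (fun=> k) z.
Proof. by move=> e e0; exists 1 => // w _; rewrite subrr cmod0. Qed.
Lemma ccont_id z : ccont (fun w => w) z.
Proof. by move=> e e0; exists e. Qed.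
Lemma ccont_comp f g z : ccont f z -> ccont g (f z) -> ccont (fun w => g (f w)) z.
Proof.
move=> cf cg e e0; have [d d0 D] := cg e e0; have [d' d'0 D'] := cf d d0.
by exists d' => // w /D' /D.
Qed.
Lemma ccontD f g z : ccont f z -> ccont g z -> ccont (fun w => f w + g w) z.
Proof.
move=> cf cg e e0; have e20 : 0 < e / 2 by lra.
have [d d0 D] := cf _ e20; have [d' d'0 D'] := cg _ e20.
exists (Num.min d d') => [|w]; first by rewrite lt_min d0.
rewrite lt_min => /andP[/D h /D' h'].
have -> : f w + g w - (f z + g z) = (f w - f z) + (g w - g z) by ring.
by rewrite (le_lt_trans (cmodD _ _))//; lra.
Qed.
Lemma ccontM f g z : ccont f z -> ccont g z -> ccont (fun w => f w * g w) z.
Proof.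
move=> cf cg e e0; have G0 := cmod_ge0 (g z); have F0 := cmod_ge0 (f z).
have a0 : 0 < e / (2 * (cmod (g z) + 1)) by rewrite divr_gt0//; lra.
have b0 : 0 < Num.min 1 (e / (2 * (cmod (f z) + 1))).
  by rewrite lt_min ltr01 divr_gt0//; lra.
have [d d0 D] := cf _ a0; have [d' d'0 D'] := cg _ b0.
exists (Num.min d d') => [|w]; first by rewrite lt_min d0.
rewrite lt_min => /andP[/D h /D']; rewrite lt_min => /andP[h1 h2].
have -> : f w * g w - f z * g z = (f w - f z) * g w + f z * (g w - g z) by ring.
rewrite (le_lt_trans (cmodD _ _))// !cmodM.
have gw : cmod (g w) <= cmod (g z) + 1.
  by have -> : g w = g z + (g w - g z); [ring|rewrite (le_trans (cmodD _ _))// lerD2l ltW].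
move: h h2; rewrite !ltr_pdivlMr; [|lra|lra].
have := cmod_ge0 (f w - f z); have := cmod_ge0 (g w - g z); have := cmod_ge0 (g w); nra.
Qed.
Lemma ccontV f z : f z != 0 -> ccont f z -> ccont (fun w => (f w)^-1) z.
Proof.
rewrite -cmod_gt0 => f0 cf e e0.
have a0 : 0 < Num.min (cmod (f z) / 2) (e * (cmod (f z) ^+ 2 / 2)).
  by rewrite lt_min divr_gt0//= mulr_gt0// divr_gt0// exprn_gt0.
have [d d0 D] := cf _ a0; exists d => // w /D; rewrite lt_min => /andP[h1 h2].
have fw : cmod (f z) / 2 <= cmod (f w).
  have : cmod (f z) <= cmod (f w) + cmod (f w - f z); last by lra.
  by have {1}-> : f z = f w - (f w - f z); [ring|exact: cmodB].
have fw0 : 0 < cmod (f w) by lra.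
have -> : (f w)^-1 - (f z)^-1 = (f z - f w) / (f w * f z).
  by field; rewrite -!cmod_gt0 f0 fw0.
have -> : cmod ((f z - f w) / (f w * f z)) = cmod (f w - f z) / (cmod (f w) * cmod (f z)).
  by rewrite cmodM cmodC [cmod (_ ^-1)]Normc.normcV -cmodM.
rewrite ltr_pdivrMr ?mulr_gt0//; apply: (lt_le_trans h2).
rewrite ler_pM2l// expr2; nra.
Qed.
Lemma ccontX f n z : ccont f z -> ccont (fun w => f w ^+ n) z.
Proof.
move=> cf; elim: n => [|n IH]; first exact: ccont_cst.
have -> : (fun w => f w ^+ n.+1) = (fun w => f w * f w ^+ n).
  by apply/funext => w; rewrite exprS.
exact: ccontM.
Qed.
Lemma ccont_sum (I : Type) (r : seq I) (P : pred I) (F : I -> R[i] -> R[i]) z :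
  (forall i, P i -> ccont (F i) z) -> ccont (fun w => \sum_(i <- r | P i) F i w) z.
Proof.
move=> cF; elim: r => [|i r IH].
  have -> : (fun w => \sum_(i <- [::] | P i) F i w) = fun=> 0.
    by apply/funext => w; rewrite big_nil.
  exact: ccont_cst.
case Pi : (P i).
  have -> : (fun w => \sum_(i <- i :: r | P i) F i w) =
     (fun w => F i w + \sum_(i <- r | P i) F i w).
    by apply/funext => w; rewrite big_cons Pi.
  by apply: ccontD => //; exact: cF.
have -> // : (fun w => \sum_(i <- i :: r | P i) F i w) =
     (fun w => \sum_(i <- r | P i) F i w).
by apply/funext => w; rewrite big_cons Pi.
Qed.

Lemma ccont_dnbhs0 f z : ccont f z ->
  (\forall w \near (z : R[i]^o)^', f w = 0) -> f z = 0.
Proof.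
move=> cf /dnbhsC_P[d d0 H]; apply/eqP; apply: contraT.
rewrite -cmod_gt0 => fz; have [d1 d10 H1] := cf _ fz.
have m0 : 0 < Num.min d d1 / 2 by rewrite divr_gt0// lt_min d0.
have mm : Num.min d d1 / 2 < Num.min d d1 by lra.
have := H (z + (Num.min d d1 / 2)%:C); have := H1 (z + (Num.min d d1 / 2)%:C).
have -> : z + (Num.min d d1 / 2)%:C - z = (Num.min d d1 / 2)%:C by ring.
rewrite cmodR gtr0_norm// => h1 h2.
move: mm; rewrite lt_min => /andP[m1 m2].
have := h1 m2; rewrite h2.
- by rewrite sub0r cmodN ltxx.
- by rewrite -subr_eq0 addrAC subrr add0r -cmod_gt0 cmodR gtr0_norm.
- exact: m1.
Qed.

(** Caratheodory's form of complex differentiability, chosen because stability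
    under products and composition becomes pure algebra. *)
Definition cdiff f z := exists2 q : R[i] -> R[i], ccont q z &
  forall w, f w = f z + q w * (w - z).

Lemma cdiff_cont f z : cdiff f z -> ccont f z.
Proof.
move=> [q cq E]; have -> : f = fun w => f z + q w * (w - z) by apply/funext => w; rewrite -E.
apply: ccontD; first exact: ccont_cst.
apply: ccontM => //; apply: ccontD; [exact: ccont_id|exact: ccont_cst].
Qed.

Lemma cdiff_cst k z : cdiff (fun=> k) z.
Proof. by exists (fun=> 0); [exact: ccont_cst|move=> w; rewrite mul0r addr0]. Qed.
Lemma cdiff_id z : cdiff (fun w => w) z.
Proof. by exists (fun=> 1); [exact: ccont_cst|move=> w; ring]. Qed.
Lemma cdiffD f g z : cdiff f z -> cdiff g z -> cdiff (fun w => f w + g w) z.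
Proof.
move=> [p cp E] [q cq F]; exists (fun w => p w + q w); first exact: ccontD.
by move=> w; rewrite E F; ring.
Qed.
Lemma cdiffM f g z : cdiff f z -> cdiff g z -> cdiff (fun w => f w * g w) z.
Proof.
move=> df dg; have [p cp E] := df; have [q cq F] := dg.
exists (fun w => p w * g w + f z * q w); last by move=> w; rewrite E F; ring.
apply: ccontD; apply: ccontM => //; [exact: cdiff_cont|exact: ccont_cst].
Qed.
Lemma cdiff_comp f g z : cdiff f z -> cdiff g (f z) -> cdiff (fun w => g (f w)) z.
Proof.
move=> df [q cq F]; have [p cp E] := df; exists (fun w => q (f w) * p w).
  by apply: ccontM => //; apply: ccont_comp => //; exact: cdiff_cont.
by move=> w; rewrite F [in X in X - f z]E; ring.
Qed.
Lemma cdiffX f n z : cdiff f z -> cdiff (fun w => f w ^+ n) z.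
Proof.
move=> cf; elim: n => [|n IH]; first exact: cdiff_cst.
have -> : (fun w => f w ^+ n.+1) = (fun w => f w * f w ^+ n).
  by apply/funext => w; rewrite exprS.
exact: cdiffM.
Qed.
Lemma cdiff_sum (I : Type) (r : seq I) (F : I -> R[i] -> R[i]) z :
  (forall i, cdiff (F i) z) -> cdiff (fun w => \sum_(i <- r) F i w) z.
Proof.
move=> cF; elim: r => [|i r IH].
  have -> : (fun w => \sum_(i <- [::]) F i w) = fun=> 0.
    by apply/funext => w; rewrite big_nil.
  exact: cdiff_cst.
have -> : (fun w => \sum_(i <- i :: r) F i w) =
   (fun w => F i w + \sum_(i <- r) F i w).
  by apply/funext => w; rewrite big_cons.
exact: cdiffD.
Qed.
Lemma cdiff_prod (I : Type) (r : seq I) (F : I -> R[i] -> R[i]) z :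
  (forall i, cdiff (F i) z) -> cdiff (fun w => \prod_(i <- r) F i w) z.
Proof.
move=> cF; elim: r => [|i r IH].
  have -> : (fun w => \prod_(i <- [::]) F i w) = fun=> 1.
    by apply/funext => w; rewrite big_nil.
  exact: cdiff_cst.
have -> : (fun w => \prod_(i <- i :: r) F i w) =
   (fun w => F i w * \prod_(i <- r) F i w).
  by apply/funext => w; rewrite big_cons.
exact: cdiffM.
Qed.

Lemma derivable_cdiff f z : derivable (f : R[i]^o -> R[i]^o) z 1 -> cdiff f z.
Proof.
move=> /cvg_ex[/= D HD].
exists (fun w => if w == z then D else (w - z)^-1 * (f w - f z)); last first.
  move=> w; have [->|wz] := eqVneq w z; first by rewrite subrr mulr0 addr0.
  by rewrite mulrC mulrA divff ?subr_eq0// mul1r subrKC.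
move=> e e0; have eC : 0 < e%:C :> R[i] by rewrite ltcR.
move/cvgrPdist_lt: HD => /(_ _ eC)/dnbhsC_P[d d0 H].
exists d => // w wd; rewrite eqxx; have [_|wz] := eqVneq w z.
  by rewrite subrr cmod0.
have := H (w - z); rewrite subr_eq0 subr0 => /(_ wz wd) /=.
rewrite normC_cmod ltcR cmodC.
have -> : (w - z) *: (1 : R[i]^o) + z = w by rewrite -[(w - z) *: _]/((w - z) * 1); ring.
by [].
Qed.

(** The Cauchy-Riemann equations. *)
Lemma cdiff_gradient f z : cdiff f z -> exists a b : R,
  has_gradient (fun x y => complex.Re (f (x +i* y))) a (- b) (complex.Re z) (complex.Im z) /\
  has_gradient (fun x y => complex.Im (f (x +i* y))) b a (complex.Re z) (complex.Im z).
Proof.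
move=> [q cq E]; exists (complex.Re (q z)), (complex.Im (q z)).
have zE : complex.Re z +i* complex.Im z = z by case: (z).
have key (e : R) : 0 < e -> exists2 d, 0 < d & forall x y : R,
    `|x - complex.Re z| + `|y - complex.Im z| < d ->
    cmod (f (x +i* y) - f z - q z * (x +i* y - z)) <=
      e * (`|x - complex.Re z| + `|y - complex.Im z|).
  move=> e0; have [d d0 H] := cq e e0; exists d => // x y h.
  have h' : cmod (x +i* y - z) <= `|x - complex.Re z| + `|y - complex.Im z|.
    by apply: le_trans (cmod_le_ReIm _) _; case: (z).
  have -> : f (x +i* y) - f z - q z * (x +i* y - z) = (q (x +i* y) - q z) * (x +i* y - z).
    by rewrite E; ring.
  rewrite cmodM ler_pM ?cmod_ge0//; apply/ltW/H.
  exact: le_lt_trans h' h.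
split=> e e0; have [d d0 H] := key e e0; exists d => // x y /H h; apply: le_trans h.
  apply: le_trans (ger_Re_cmod _); rewrite zE le_eqVlt; apply/orP; left; apply/eqP; congr `|_|.
  move: (f _) (f _) (q z) => [a1 a2] [b1 b2] [c1 c2]; case: (z) => z1 z2 /=; ring.
apply: le_trans (ger_Im_cmod _); rewrite zE le_eqVlt; apply/orP; left; apply/eqP; congr `|_|.
move: (f _) (f _) (q z) => [a1 a2] [b1 b2] [c1 c2]; case: (z) => z1 z2 /=; ring.
Qed.
End Caratheodory.

(** * The exponential *)

Section Exponential.
Variable R : realType.
Implicit Types (z w : R[i]) (x y : R).

Lemma cexpD z w : cexp (z + w) = cexp z * cexp w.
Proof.
case: z => a b; case: w => c d; rewrite /cexp/= expRD cosD sinD; simpc.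
by congr (_ +i* _); ring.
Qed.
Lemma cexp0 : cexp (0 : R[i]) = 1.
Proof. by rewrite /cexp/= expR0 cos0 sin0; simpc. Qed.
Lemma cmod_cexp z : cmod (cexp z) = expR (complex.Re z).
Proof.
case: z => x y; rewrite /cexp cmodM cmodR ger0_norm ?expR_ge0//.
by rewrite /cmod/= cos2Dsin2 sqrtr1 mulr1.
Qed.
Lemma cexp_neq0 z : cexp z != 0.
Proof. by rewrite -cmod_gt0 cmod_cexp expR_gt0. Qed.

Lemma is_derive_near (f : R -> R) (a : R) : is_derive (0 : R) (1 : R) f a ->
  forall e, 0 < e -> exists2 d, 0 < d & forall x, `|x| < d -> `|f x - f 0 - a * x| <= e * `|x|.
Proof.
move=> /is_derive1_caratheodory[g [E cg ga]] e e0.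
move/cvgrPdist_le: cg => /(_ _ e0)/nbhs_ballP[d /= d0 H].
exists d => // x xd; rewrite E subr0 -ga -mulrBl normrM ler_wpM2r// distrC.
by apply: H; rewrite /ball/= sub0r normrN.
Qed.

Lemma cexp_near0 (e : R) : 0 < e -> exists2 d : R, 0 < d &
  forall h : R[i], cmod h < d -> cmod (cexp h - 1 - h) <= e * cmod h.
Proof.
move=> e0; pose e1 := Num.min (e / 8) (1 / 2).
have e10 : 0 < e1 by rewrite lt_min; apply/andP; split; lra.
have e1e : e1 <= e / 8 by rewrite ge_min lexx.
have e1h : e1 <= 1 / 2 by rewrite ge_min lexx orbT.
clearbody e1.
have [d1 d10 H1] := is_derive_near (is_derive_expR 0) e10.
have [d2 d20 H2] := is_derive_near (is_derive_cos 0) e10.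
have [d3 d30 H3] := is_derive_near (is_derive_sin 0) e10.
exists (Num.min (Num.min d1 d2) (Num.min d3 e1)); first by rewrite !lt_min d10 d20 d30 e10.
move=> [x y]; rewrite !lt_min => /andP[/andP[h1 h2] /andP[h3 h4]].
have hx : `|x| <= cmod (x +i* y) := ger_Re_cmod (x +i* y).
have hy : `|y| <= cmod (x +i* y) := ger_Im_cmod (x +i* y).
set h := cmod (x +i* y) in h1 h2 h3 h4 hx hy *.
have K1 := H1 x (le_lt_trans hx h1).
have K2 := H2 y (le_lt_trans hy h2).
have K3 := H3 y (le_lt_trans hy h3).
rewrite expR0 mul1r in K1; rewrite cos0 sin0 oppr0 mul0r subr0 in K2.
rewrite cos0 sin0 subr0 mul1r in K3.
have -> : cexp (x +i* y) - 1 - (x +i* y) = (expR x * cos y - 1 - x) +i* (expR x * sin y - y).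
  by apply/eqP; rewrite eq_complex /=; apply/andP; split; apply/eqP; ring.
apply: (le_trans (cmod_le_ReIm _)); rewrite [complex.Re _]/= [complex.Im _]/=.
have X0 := normr_ge0 x; have Y0 := normr_ge0 y.
set a := expR x - 1 - x in K1; set b := cos y - 1 in K2; set c := sin y - y in K3.
have -> : expR x * cos y - 1 - x = a + (1 + x + a) * b by rewrite /a /b; ring.
have -> : expR x * sin y - y = (x + a) * (y + c) + c by rewrite /a /c; ring.
have A1 : `|a| <= e1 * h by apply: le_trans K1 _; rewrite ler_pM2l.
have B1 : `|b| <= e1 * h by apply: le_trans K2 _; rewrite ler_pM2l.
have C1 : `|c| <= e1 * h by apply: le_trans K3 _; rewrite ler_pM2l.
have h0 : 0 <= h by exact: cmod_ge0.
clearbody h a b c; clear -e0 e10 e1e e1h h0 h4 hx hy A1 B1 C1.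
have A2 : `|1 + x + a| <= 2.
  rewrite (le_trans (ler_normD _ _))// (le_trans (lerD (ler_normD _ _) (lexx _)))//.
  rewrite normr1; nra.
have A3 : `|x + a| <= 2 * e1 by rewrite (le_trans (ler_normD _ _))//; nra.
have A4 : `|y + c| <= 2 * h by rewrite (le_trans (ler_normD _ _))//; nra.
have M1 : `|(1 + x + a) * b| <= 2 * (e1 * h) by rewrite normrM ler_pM.
have M2 : `|(x + a) * (y + c)| <= 2 * e1 * (2 * h) by rewrite normrM ler_pM.
have N1 := ler_normD a ((1 + x + a) * b).
have N2 := ler_normD ((x + a) * (y + c)) c.
have e1h8 : e1 * h <= e / 8 * h by rewrite ler_wpM2r.
clear -M1 M2 N1 N2 A1 C1 e1h8 e10 e1h h0; have : 2 * e1 * (2 * h) = 4 * (e1 * h) by ring.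
lra.
Qed.

Lemma cdiff_cexp z : cdiff (@cexp R) z.
Proof.
exists (fun w => if w == z then cexp z else (cexp w - cexp z) / (w - z)); last first.
  move=> w; have [->|wz] := eqVneq w z; first by rewrite subrr mulr0 addr0.
  by rewrite divfK ?subr_eq0// subrKC.
move=> e e0; rewrite eqxx.
have c0 : 0 < cmod (cexp z) by rewrite cmod_gt0 cexp_neq0.
have [d d0 H] := @cexp_near0 (e / 2 / cmod (cexp z)) (divr_gt0 (divr_gt0 e0 (ltr0Sn _ _)) c0).
exists d => // w wd; have [_|wz] := eqVneq w z; first by rewrite subrr cmod0.
have -> : (cexp w - cexp z) / (w - z) - cexp z =
    cexp z * (cexp (w - z) - 1 - (w - z)) / (w - z).
  have -> : cexp w = cexp z * cexp (w - z) by rewrite -cexpD subrKC.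
  by field; rewrite subr_eq0.
have p0 : 0 < cmod (w - z) by rewrite cmod_gt0 subr_eq0.
rewrite !cmodM.
have -> : cmod (w - z)^-1 = (cmod (w - z))^-1 by exact: Normc.normcV.
rewrite ltr_pdivrMr//.
have := H (w - z) wd.
rewrite -(ler_pM2l c0) => h; apply: (le_lt_trans h).
have -> : cmod (cexp z) * (e / 2 / cmod (cexp z) * cmod (w - z)) = e / 2 * cmod (w - z).
  by field; rewrite gt_eqF.
rewrite ltr_pM2r//; lra.
Qed.

Definition cis (t : R) : R[i] := cos t +i* sin t.
Lemma cexpE x y : cexp (x +i* y) = (expR x)%:C * cis y. Proof. by []. Qed.
Lemma cis_cexp y : cis y = cexp (0 +i* y). Proof. by rewrite cexpE expR0 mul1r. Qed.
Lemma cisD s t : cis (s + t) = cis s * cis t.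
Proof. by rewrite !cis_cexp -cexpD; congr cexp; simpc. Qed.
Lemma cmod_cis t : cmod (cis t) = 1.
Proof. by rewrite cis_cexp cmod_cexp expR0. Qed.
Lemma cis0 : cis 0 = 1. Proof. by rewrite /cis cos0 sin0. Qed.
Lemma cis2pi : cis (pi *+ 2) = 1.
Proof. by rewrite /cis cos2pi sin2pi. Qed.
Lemma cis_near0 (e : R) : 0 < e ->
  exists2 d : R, 0 < d & forall t, `|t| < d -> cmod (cis t - 1) < e.
Proof.
move=> e0; have [d d0 H] := cdiff_cont (cdiff_cexp 0) e0.
exists d => // t td; rewrite cis_cexp -cexp0; apply: H; rewrite subr0.
by rewrite (le_lt_trans (cmod_le_ReIm _))//= normr0 add0r.
Qed.
End Exponential.

(** * The maximum principle at the centre of a disk *)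

Section MeanValue.
Variable R : realType.
Implicit Types (f F : R[i] -> R[i]) (z w c u : R[i]) (r x y t m M : R).

Lemma segint_le_cst (f : R -> R) k a b : a <= b -> {in `[a, b], continuous f} ->
  (forall x, a <= x <= b -> f x <= k) -> segint f a b <= k * (b - a).
Proof.
move=> ab cf fk; rewrite -segint_cst//; apply: le_Rintegral => //.
- exact: continuous_segment_integrable.
- by apply: continuous_segment_integrable => x _; exact: cvg_cst.
Qed.

(** Write G(z) = conj(F(0)) F(r exp(z)), u = Re G and v = Im G.  By periodicity
    of v in y the flux identity says that the integral of u(x, y) over
    0 <= y <= 2 pi does not depend on x <= 0.  At x = 0 the integrand is at most
    |F(0)| M, and for x close to - oo it is close to |F(0)|^2. *)
Lemma cmod_center_le F r M : 0 < r ->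
  (forall w, cmod w <= r -> cdiff F w) ->
  (forall t, 0 <= t <= pi *+ 2 -> cmod (F (r%:C * cis t)) <= M) ->
  cmod (F 0) <= M.
Proof.
move=> r0 dF FM; have pi0 := pi_gt0 R.
set m := cmod (F 0).
have m0 : 0 <= m by exact: cmod_ge0.
rewrite leNgt; apply/negP => Mm.
have mM : 0 < m * (m - M).
  rewrite mulr_gt0 ?subr_gt0//; apply: le_lt_trans Mm.
  by apply: le_trans (FM 0 _); [exact: cmod_ge0|rewrite lexx mulrn_wge0// ltW].
set e := m * (m - M) / 2.
have e0 : 0 < e by rewrite divr_gt0.
pose G z := (F 0)^*%C * F (r%:C * cexp z).
have dG z : complex.Re z <= 0 -> cdiff G z.
  move=> z0; apply: cdiffM; first exact: cdiff_cst.
  apply: (cdiff_comp (f := fun w => r%:C * cexp w)).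
    by apply: cdiffM; [exact: cdiff_cst|exact: cdiff_cexp].
  apply: dF; rewrite cmodM cmodR gtr0_norm// cmod_cexp ger_pMr//.
  by rewrite -expR0 ler_expR.
pose u x y := complex.Re (G (x +i* y)); pose v x y := complex.Im (G (x +i* y)).
have Gu x y : 0 <= `|u x y| <= cmod (G (x +i* y)) by rewrite normr_ge0 ger_Re_cmod.
have [a a0 Ga] : exists2 a, a <= 0 & forall y, u a y >= m ^+ 2 - e.
  have e1 : 0 < e / (m + 1) by rewrite divr_gt0//; lra.
  have [d d0 H] := cdiff_cont (dF 0 ltac:(by rewrite cmod0 ltW)) e1.
  (* the circle of radius r exp(a) <= d / 2 lies in the disk of radius d *)
  exists (Num.min 0 (ln (d / (2 * r)))) => [|y]; first by rewrite ge_min lexx.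
  set a := Num.min _ _.
  have ea : expR a <= d / (2 * r).
    rewrite -[X in _ <= X]lnK; last by rewrite posrE divr_gt0// mulr_gt0.
    by rewrite ler_expR ge_min lexx orbT.
  have h : cmod (r%:C * cexp (a +i* y) - 0) < d.
    rewrite subr0 cmodM cmodR gtr0_norm// cmod_cexp [complex.Re _]/=.
    have : r * expR a <= r * (d / (2 * r)) by rewrite ler_pM2l.
    have -> : r * (d / (2 * r)) = d / 2 by field; rewrite gt_eqF.
    lra.
  have := H _ h; rewrite ltr_pdivlMr; last by lra.
  move=> h1.
  have : `|complex.Re (G (a +i* y) - (m ^+ 2)%:C)| <= e.
    apply: le_trans (ger_Re_cmod _) _.
    rewrite -conjM_cmod /G -mulrBr cmodM cmod_conj -/m.
    have := cmod_ge0 (F (r%:C * cexp (a +i* y)) - F 0); nra.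
  by rewrite raddfB/= -/(u a y) ler_norml => /andP[+ _]; lra.
have u0 y : 0 <= y <= pi *+ 2 -> u 0 y <= m * M.
  move=> hy; apply: le_trans (ler_norm _) _; have /andP[_] := Gu 0 y.
  move/le_trans; apply; rewrite /G cmodM cmod_conj -/m ler_wpM2l//.
  by rewrite cexpE expR0 mul1r; exact: FM.
have grad x y : x <= 0 -> exists al be ga : R,
    has_gradient u al be x y /\ has_gradient v ga al x y.
  move=> x0; have [p [q [H1 H2]]] := cdiff_gradient (dG (x +i* y) x0).
  by exists p, (- q), q.
have p20 : 0 <= pi *+ 2 :> R by rewrite mulrn_wge0// ltW.
have E : segint (fun y => u 0 y - u a y) 0 (pi *+ 2) =
         segint (fun x => v x (pi *+ 2) - v x 0) a 0.
  apply: divergence_free_rectangle => // x y /andP[_ x0] _; exact: grad.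
have per x : v x (pi *+ 2) = v x 0 by rewrite /v /G !cexpE cis2pi cis0.
have Z : segint (fun x => v x (pi *+ 2) - v x 0) a 0 = 0.
  have -> : (fun x => v x (pi *+ 2) - v x 0) = fun=> 0.
    by apply/funext => x; rewrite per subrr.
  by rewrite segint_cst// mul0r.
have cont x : x <= 0 -> {in `[0, pi *+ 2], continuous (u x)}.
  move=> x0 y _; have [al [be [ga [h _]]]] := grad x y x0.
  exact: has_gradient_continuousr h.
have : segint (fun y => u 0 y - u a y) 0 (pi *+ 2) <= (- e) * (pi *+ 2 - 0).
  apply: segint_le_cst => //.
    by move=> y hy; apply: cvgB; apply: cont.
  move=> y /u0; have := Ga y; rewrite /e; lra.
rewrite E Z subr0 mulNr oppr_ge0 leNgt mulr_gt0//; first by rewrite mulrn_wgt0.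
Qed.

(** Finitely many rotations of an arc cover the circle, and their number only
    depends on the length of the arc. *)
Lemma rotation_cover (d : R) : 0 < d -> exists N : nat, forall u, cmod u = 1 ->
  exists2 rot : 'I_N.+1 -> R[i], forall k, cmod (rot k) = 1 &
    forall t, 0 <= t <= pi *+ 2 -> exists k, cmod (rot k * cis t - u) < d.
Proof.
move=> d0; have [h h0 H] := cis_near0 d0; have pi0 := pi_gt0 R.
have p2 : 0 < pi *+ 2 :> R by rewrite mulrn_wgt0.
pose N := Num.bound (pi *+ 2 / h); exists N => u u1.
have Nh : pi *+ 2 / N.+1%:R < h.
  rewrite ltr_pdivrMr// mulrC -ltr_pdivrMr//.
  apply: lt_trans (archi_boundP _) _; first by rewrite divr_ge0// ltW.
  by rewrite ltr_nat.
set al : R := pi *+ 2 / N.+1%:R in Nh *.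
have al0 : 0 < al by rewrite divr_gt0.
have alN : N.+1%:R * al = pi *+ 2 by rewrite /al mulrC divfK.
clearbody al.
exists (fun k : 'I_N.+1 => u * cis (- (al * k%:R))) => [k|t /andP[t0 t2]].
  by rewrite cmodM u1 cmod_cis mul1r.
have [k kt] : exists k : 'I_N.+1, `|t - al * k%:R| < h.
  have ta0 : 0 <= t / al by rewrite divr_ge0// ltW.
  have := truncn_itv ta0; set j := Num.truncn _ => /andP[j1 j2].
  have {}j1 : j%:R * al <= t by rewrite -ler_pdivlMr.
  have {}j2 : t < j.+1%:R * al by rewrite -ltr_pdivrMr.
  have [jN|jN] := ltnP j N.+1.
    exists (Ordinal jN) => /=; apply: le_lt_trans Nh; rewrite ler_norml.
    move: j1 j2; rewrite -natr1 mulrDl mul1r; lra.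
  (* the end point t = 2 pi belongs to the last arc *)
  have tE : t = pi *+ 2.
    apply/le_anti; rewrite t2 /= -alN; apply: le_trans j1.
    by rewrite ler_pM2r// ler_nat.
  exists ord_max => /=; apply: le_lt_trans Nh; rewrite tE -alN -natr1 mulrDl mul1r.
  by rewrite mulrC addrAC subrr add0r gtr0_norm.
exists k; have -> : u * cis (- (al * k%:R)) * cis t - u = u * (cis (t - al * k%:R) - 1).
  by rewrite addrC cisD; ring.
by rewrite cmodM u1 mul1r; exact: H.
Qed.

(** The maximum principle applied to the product of the rotated copies of f,
    whose value at the centre is f(c) ^ N. *)
Lemma rotated_prod_le f c r K (N : nat) (rot : 'I_N -> R[i]) : 0 < r ->
  (forall k, cmod (rot k) = 1) ->
  (forall w, cmod (w - c) <= r -> cdiff f w) ->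
  (forall t, 0 <= t <= pi *+ 2 -> \prod_k cmod (f (c + r%:C * (rot k * cis t))) <= K) ->
  cmod (f c) ^+ N <= K.
Proof.
move=> r0 rot1 df fK.
pose F w := \prod_(k < N) f (c + rot k * w).
have F0 : F 0 = f c ^+ N.
  rewrite /F (eq_bigr (fun=> f c)) => [|k _]; last by rewrite mulr0 addr0.
  by rewrite prodr_const card_ord.
rewrite -cmodX -F0; apply: (cmod_center_le r0).
  move=> w wr; apply: cdiff_prod => k; apply: (cdiff_comp (f := fun w => c + rot k * w)).
    by apply: cdiffD; [exact: cdiff_cst|apply: cdiffM; [exact: cdiff_cst|exact: cdiff_id]].
  by apply: df; rewrite addrAC subrr add0r cmodM rot1 mul1r.
move=> t /fK; rewrite cmod_prod; congr (_ <= _).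
by apply: eq_bigr => k _; congr (cmod (f (_ + _))); ring.
Qed.

(** A bound m on a single arc is inherited by the centre: on each point of the
    circle at least one of the rotated factors is at most m. *)
Lemma arc_bound (d : R) : 0 < d -> exists N : nat, forall f c u r M m,
  0 < r -> cmod u = 1 -> 0 <= M -> 0 <= m ->
  (forall w, cmod (w - c) <= r -> cdiff f w) ->
  (forall w, cmod (w - c) = r -> cmod (f w) <= M) ->
  (forall v, cmod v = 1 -> cmod (v - u) < d -> cmod (f (c + r%:C * v)) <= m) ->
  cmod (f c) ^+ N.+1 <= m * M ^+ N.
Proof.
move=> /rotation_cover[N HN]; exists N => f c u r M m r0 /HN[rot rot1 cover] M0 m0 df fM fm.
apply: (rotated_prod_le r0 rot1 df) => t /cover[k kd].
have ct i : cmod (rot i * cis t) = 1 by rewrite cmodM rot1 cmod_cis mulr1.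
rewrite (bigD1 k)//=; apply: ler_pM; first exact: cmod_ge0.
- by apply: prodr_ge0 => i _; exact: cmod_ge0.
- exact: fm.
apply: le_trans (_ : \prod_(i < N.+1 | i != k) M <= _).
  apply: ler_prod => i _; rewrite cmod_ge0/=; apply: fM.
  by rewrite addrAC subrr add0r cmodM cmodR ct mulr1 gtr0_norm.
rewrite (eq_bigl (mem (predC1 k))) => [|i]; last by rewrite inE.
by rewrite prodr_const cardC1 card_ord.
Qed.

(** The zeros near b fill an arc of the circle of centre c through b, so the
    product of the rotated copies of f vanishes on the whole circle. *)
Lemma zero_propagates f c b :
  (forall w, cmod (w - c) <= cmod (b - c) -> cdiff f w) ->
  (\forall w \near (b : R[i]^o), f w = 0) ->
  f c = 0.
Proof.
move=> df /nbhsC_P[d d0 fb].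
have [->|bc] := eqVneq c b; first by apply: fb; rewrite subrr cmod0.
set r := cmod (b - c); have r0 : 0 < r by rewrite cmod_gt0 subr_eq0 eq_sym.
pose u := (r^-1)%:C * (b - c).
have u1 : cmod u = 1 by rewrite cmodM cmodR ger0_norm ?invr_ge0 ?ltW// mulVf// gt_eqF.
have rv v : c + r%:C * v - b = r%:C * (v - u).
  by rewrite /u mulrBr mulrA -rmorphM/= mulfV ?gt_eqF// mul1r; ring.
have [N /(_ u u1)[rot rot1 cover]] := rotation_cover (divr_gt0 d0 r0).
have : cmod (f c) ^+ N.+1 <= 0.
  apply: (rotated_prod_le r0 rot1 df) => t /cover[k kd].
  rewrite (bigD1 k)//= fb ?cmod0 ?mul0r//.
  by rewrite rv cmodM cmodR gtr0_norm// mulrC -ltr_pdivlMr.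
move=> h; apply/eqP; rewrite -cmod_eq0 -(andTb (_ == 0)) -(expf_eq0 _ N.+1).
by apply/eqP/le_anti; rewrite h exprn_ge0// cmod_ge0.
Qed.
End MeanValue.

(** * The identity principle *)

Section Identity.
Variable R : realType.
Implicit Types (f phi : R[i] -> R[i]) (z w c : R[i]).

Definition near_eq phi c z := exists2 d : R, 0 < d &
  forall w, w != z -> cmod (w - z) < d -> phi w = c.

(** Near z, the function f = u - c (w - z) ^ n is differentiable, and it
    vanishes exactly where phi = c.  If it vanishes near a point b which is
    close to z, then it vanishes at each w close to z, since the disk of centre
    w through b stays in the domain. *)
Lemma meromorphic_cst_closed phi c z : meromorphic phi ->
  exists2 d : R, 0 < d & forall b, cmod (b - z) < d -> near_eq phi c b -> near_eq phi c z.
Proof.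
move=> /(_ z)[n [u [/nbhsC_P[d1 d10 hu] /dnbhsC_P[d2 d20 hphi]]]].
pose d := Num.min d1 d2; have d0 : 0 < d by rewrite lt_min d10.
have [dd1 dd2] : d <= d1 /\ d <= d2 by rewrite !ge_min !lexx orbT.
clearbody d.
exists (d / 4); first by rewrite divr_gt0.
move=> b bz hb; have [<-//|nbz] := eqVneq b z.
pose f w := u w - c * (w - z) ^+ n.
have df w : cmod (w - z) < d -> cdiff f w.
  move=> wz; apply: cdiffD; first by apply/derivable_cdiff/hu; exact: lt_le_trans wz dd1.
  have -> : (fun w => - (c * (w - z) ^+ n)) = (fun w => (- c) * (w - z) ^+ n).
    by apply/funext => x; rewrite mulNr.
  apply: cdiffM; first exact: cdiff_cst.
  by apply: cdiffX; apply: cdiffD; [exact: cdiff_id|exact: cdiff_cst].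
have fE w : w != z -> cmod (w - z) < d -> f w = (w - z) ^+ n * (phi w - c).
  move=> wz wd; rewrite /f -hphi//; first by ring.
  exact: lt_le_trans wd dd2.
have fb : \forall w \near (b : R[i]^o), f w = 0.
  move: hb => [d3 d30 hb].
  have p0 : 0 < Num.min d3 (Num.min (cmod (b - z)) (d / 4)).
    by rewrite !lt_min d30 cmod_gt0 subr_eq0 nbz divr_gt0.
  have fw w : w != b -> cmod (w - b) < Num.min d3 (Num.min (cmod (b - z)) (d / 4)) -> f w = 0.
    rewrite !lt_min => wb /andP[h1 /andP[h2 h3]].
    have wd : cmod (w - z) < d.
      have -> : w - z = (w - b) + (b - z) by ring.
      by rewrite (le_lt_trans (cmodD _ _))//; lra.
    have wz : w != z by apply: contraTneq h2 => ->; rewrite cmodC ltxx.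
    by rewrite fE// hb// subrr mulr0.
  have f0 : f b = 0.
    apply: ccont_dnbhs0; first by apply/cdiff_cont/df; apply: lt_le_trans bz _; lra.
    by apply/dnbhsC_P; exists (Num.min d3 (Num.min (cmod (b - z)) (d / 4))).
  apply/nbhsC_P; exists (Num.min d3 (Num.min (cmod (b - z)) (d / 4))) => // w wb.
  by have [->//|] := eqVneq w b; move/fw; apply.
exists (d / 4); first by rewrite divr_gt0.
move=> w wz wd; have : f w = 0.
  apply: (@zero_propagates _ f w b) => // w'.
  have : cmod (b - w) <= cmod (b - z) + cmod (w - z).
    by rewrite (cmodC w z); have {1}-> : b - w = (b - z) + (z - w); [ring|exact: cmodD].
  move=> h1 h2; apply: df.
  have -> : w' - z = (w' - w) + (w - z) by ring.
  by rewrite (le_lt_trans (cmodD _ _))//; lra.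
rewrite fE//; last by lra.
move/eqP; rewrite mulf_eq0 expf_eq0 [w - z == 0]subr_eq0 (negPf wz) andbF/= subr_eq0.
by move/eqP.
Qed.

Lemma near_eq_open phi c z : near_eq phi c z ->
  exists2 d : R, 0 < d & forall b, cmod (b - z) < d -> near_eq phi c b.
Proof.
move=> hz; have [d d0 H] := hz; exists d => // b bd.
have [->//|bz] := eqVneq b z.
exists (Num.min (cmod (b - z)) (d - cmod (b - z))).
  by rewrite lt_min subr_gt0 bd cmod_gt0 subr_eq0 bz.
move=> w wb; rewrite lt_min => /andP[h1 h2]; apply: H.
  by apply: contraTneq h1 => ->; rewrite cmodC ltxx.
have -> : w - z = (w - b) + (b - z) by ring.
by rewrite (le_lt_trans (cmodD _ _))//; lra.
Qed.

Lemma clopen_setT (S : set R) : S 0 ->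
  (forall s, S s -> exists2 d, 0 < d & forall t, `|s - t| < d -> S t) ->
  (forall s, exists2 d, 0 < d & forall t, `|s - t| < d -> S t -> S s) ->
  forall s, S s.
Proof.
move=> S0 So Sc s.
have /(_ S) : connected [set: R] by apply/connected_intervalP.
have op : open S.
  rewrite openE => x Sx; apply/nbhs_ballP.
  by have [d d0 H] := So x Sx; exists d => // y; exact: H.
have cl : open (~` S).
  rewrite openE => x Sx; apply/nbhs_ballP.
  by have [d d0 H] := Sc x; exists d => // y xy Sy; apply: Sx; exact: H Sy.
move=> -> //; first by exists 0.
- by exists S => //; rewrite setTI.
- by exists S; [rewrite -[S]setCK; exact: open_closedC|rewrite setTI].
Qed.

(** The points near which phi equals c form a clopen set along the segment
    from z0 to any other point. *)
Lemma meromorphic_identity phi c z0 : meromorphic phi ->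
  near_eq phi c z0 -> mer_eq phi (fun=> c).
Proof.
move=> mphi h0 z.
pose p (s : R) := z0 + s%:C * (z - z0).
pose K := cmod (z - z0) + 1.
have K0 : 0 < K by have := cmod_ge0 (z - z0); rewrite /K; lra.
have pd s t : cmod (p t - p s) <= `|s - t| * K.
  have -> : p t - p s = (t - s)%:C * (z - z0) by rewrite /p rmorphB/=; ring.
  by rewrite cmodM cmodR distrC ler_wpM2l// /K; lra.
suff [d d0 H] : near_eq phi c (p 1).
  by apply/dnbhsC_P; exists d => // w; move: H; rewrite /p mul1r subrKC; apply.
move: 1; apply: clopen_setT; first by rewrite /p mul0r addr0.
- move=> s /near_eq_open[d d0 H]; exists (d / K); first by rewrite divr_gt0.
  by move=> t; rewrite ltr_pdivlMr// => st; apply: H; exact: le_lt_trans st.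
- move=> s; have [d d0 H] := meromorphic_cst_closed c (p s) mphi.
  exists (d / K); first by rewrite divr_gt0.
  by move=> t; rewrite ltr_pdivlMr// => st; apply: H; exact: le_lt_trans st.
Qed.
End Identity.

(** * Subexponential growth *)

Section Growth.
Variable R : realType.
Implicit Types (f g : R[i] -> R[i]) (z w : R[i]).

(** Growth of order at most one and minimal type: a weakening of order < 1 for
    which stability under sums and products is immediate. *)
Definition subexp f := forall e : R, 0 < e ->
  exists2 A : R, 0 < A & forall z, cmod (f z) <= A * expR (e * cmod z).

Lemma subexp_cst k : subexp (fun=> k).
Proof.
move=> e e0; have k0 := cmod_ge0 k; exists (cmod k + 1) => [|z]; first by lra.
apply: le_trans (_ : (cmod k + 1) * 1 <= _); first by lra.
rewrite ler_pM2l; last by lra.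
by rewrite -expR0 ler_expR mulr_ge0// ?cmod_ge0// ltW.
Qed.

Lemma subexpD f g : subexp f -> subexp g -> subexp (fun z => f z + g z).
Proof.
move=> hf hg e e0; have [A A0 HA] := hf e e0; have [B B0 HB] := hg e e0.
exists (A + B) => [|z]; first by lra.
by rewrite (le_trans (cmodD _ _))// mulrDl lerD.
Qed.

Lemma subexpM f g : subexp f -> subexp g -> subexp (fun z => f z * g z).
Proof.
move=> hf hg e e0; have e20 : 0 < e / 2 by lra.
have [A A0 HA] := hf _ e20; have [B B0 HB] := hg _ e20.
exists (A * B) => [|z]; first by rewrite mulr_gt0.
rewrite cmodM; have -> : e * cmod z = e / 2 * cmod z + e / 2 * cmod z by lra.
by rewrite expRD mulrACA ler_pM ?cmod_ge0.
Qed.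

Lemma subexpX f n : subexp f -> subexp (fun z => f z ^+ n).
Proof.
move=> hf; elim: n => [|n IH]; first exact: subexp_cst.
have -> : (fun w => f w ^+ n.+1) = (fun w => f w * f w ^+ n).
  by apply/funext => w; rewrite exprS.
exact: subexpM.
Qed.

Lemma subexp_sum (I : Type) (r : seq I) (F : I -> R[i] -> R[i]) :
  (forall i, subexp (F i)) -> subexp (fun w => \sum_(i <- r) F i w).
Proof.
move=> cF; elim: r => [|i r IH].
  have -> : (fun w => \sum_(i <- [::]) F i w) = fun=> 0.
    by apply/funext => w; rewrite big_nil.
  exact: subexp_cst.
have -> : (fun w => \sum_(i <- i :: r) F i w) =
   (fun w => F i w + \sum_(i <- r) F i w).
  by apply/funext => w; rewrite big_cons.
exact: subexpD.
Qed.

(** Beyond T = (B / e) ^ (1 / (1 - rho)) the linear term dominates. *)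
Lemma power_le_affine (B rho e : R) : 0 < B -> 0 < rho -> rho < 1 -> 0 < e ->
  exists C : R, forall t, 0 <= t -> B * t `^ rho <= e * t + C.
Proof.
move=> B0 rho0 rho1 e0; pose T : R := (B / e) `^ (1 - rho)^-1.
have T0 : 0 < T by rewrite powR_gt0// divr_gt0.
exists (B * T `^ rho) => t t0.
have BT : 0 <= B * T `^ rho by rewrite mulr_ge0 ?powR_ge0// ltW.
have [tT|Tt] := leP t T.
  apply: le_trans (_ : B * T `^ rho <= _); last by rewrite lerDr mulr_ge0// ltW.
  by rewrite ler_pM2l// ge0_ler_powR// ?nnegrE// ltW.
apply: le_trans (_ : e * t <= _); last by rewrite lerDl.
have tE : t = t `^ (1 - rho) * t `^ rho.
  rewrite -powRD; last by rewrite subrK oner_eq0.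
  by rewrite subrK powRr1.
rewrite [X in _ <= e * X]tE mulrA ler_wpM2r ?powR_ge0//.
have -> : B = e * (T `^ (1 - rho)).
  rewrite /T -powRrM mulVf ?subr_eq0 ?gt_eqF// powRr1.
    by field; rewrite gt_eqF.
  by rewrite divr_ge0// ltW.
rewrite ler_pM2l// ge0_ler_powR// ?nnegrE ?subr_ge0//; exact: ltW.
Qed.

Lemma O_lt1_subexp g : O_lt1 g -> subexp g.
Proof.
move=> [_ /ereal_inf_lt[_ [rho [rho0 [A [B [A0 B0 H]]]] <-]]]; rewrite lte_fin => rho1.
move=> e e0; have [C HC] := power_le_affine B0 rho0 rho1 e0.
exists (A * expR C) => [|z]; first by rewrite mulr_gt0// expR_gt0.
apply: (le_trans (H z)); rewrite -mulrA -expRD ler_pM2l// ler_expR addrC.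
exact/HC/cmod_ge0.
Qed.

Lemma O_lt1_cdiff g : O_lt1 g -> forall z, cdiff g z.
Proof. by move=> [eg _] z; exact/derivable_cdiff/eg. Qed.
End Growth.

(** * Polynomials along rays *)

Section Directions.
Variable R : realType.
Implicit Types (D : {poly R[i]}) (u v a : R[i]).

(** For nonconstant D this says that exp(D) decays along the ray of direction
    u, since the leading term governs the behaviour at infinity. *)
Definition decays D u := complex.Re (lead_coef D * u ^+ (size D).-1) < 0.

(** Uniformity in a neighbourhood of u comes from the continuity of the leading
    term in the direction; the other terms are O(r ^ (deg D - 1)).  A single e
    measures the width of the arc, the rate of decay and the radius from which
    it holds, so that these bounds are easily made uniform over a finite set. *)
Lemma decays_ray D a u : (1 < size D)%N -> cmod u = 1 -> decays D u ->
  exists2 e : R, 0 < e & forall (v : R[i]) (r : R),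
    cmod v = 1 -> cmod (v - u) < e -> e^-1 <= r ->
    complex.Re D.[a + r%:C * v] <= - e * r.
Proof.
move=> sD u1 dD.
set E := D \Po ('X + a%:P).
have sX : size ('X + a%:P : {poly R[i]}) = 2 by rewrite size_XaddC.
have sE : size E = size D by rewrite /E size_comp_poly2.
have lE : lead_coef E = lead_coef D.
  by rewrite /E lead_coef_comp ?sX// lead_coefXaddC expr1n mulr1.
have hE x : D.[a + x] = E.[x] by rewrite /E horner_comp !hornerE addrC.
have [m mE] : exists m, size E = m.+2.
  by rewrite sE; case: (size D) sD => [|[|m]]// _; exists m.
rewrite /decays -lE -sE mE /= in dD.
set ka := - complex.Re (lead_coef E * u ^+ m.+1).
have ka0 : 0 < ka by rewrite oppr_gt0.
have [d d0 Hd] := @ccontM R _ _ u (ccont_cst (lead_coef E) u)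
  (ccontX m.+1 (ccont_id u)) _ (divr_gt0 ka0 (ltr0Sn R 1)).
pose S := \sum_(i < m.+1) cmod E`_i.
have S0 : 0 <= S by apply: sumr_ge0 => i _; exact: cmod_ge0.
pose r0 := 1 + 4 * S / ka.
have Sk : 0 <= 4 * S / ka by rewrite divr_ge0// ?mulr_ge0// ltW.
have r00 : 0 < r0 by rewrite /r0; lra.
pose e := Num.min (Num.min d (ka / 4)) r0^-1.
have e0 : 0 < e by rewrite !lt_min d0 divr_gt0//= invr_gt0.
have [ed ek er] : [/\ e <= d, e <= ka / 4 & e <= r0^-1].
  by rewrite /e !ge_min !lexx !orbT.
exists e => // v r v1 vu re.
have r0r : r0 <= r.
  by apply: le_trans re; rewrite -[r0]invrK lef_pV2// posrE invr_gt0.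
have r1 : 1 <= r by move: r0r; rewrite /r0; lra.
have r4 : 4 * S <= ka * r.
  by rewrite [ka * r]mulrC -ler_pdivrMr//; move: r0r; rewrite /r0; lra.
have rm n : 1 <= r ^+ n by rewrite exprn_ege1.
rewrite hE horner_coef mE big_ord_recr/= raddfD/=.
have T1 : complex.Re (\sum_(i < m.+1) E`_i * (r%:C * v) ^+ i) <= S * r ^+ m.
  apply: le_trans (ler_norm _) _; apply: le_trans (ger_Re_cmod _) _.
  apply: le_trans (cmod_sum _ _ _) _; rewrite /S mulr_suml; apply: ler_sum => i _.
  rewrite cmodM ler_wpM2l ?cmod_ge0// cmodX cmodM v1 mulr1 cmodR ger0_norm; last by lra.
  by rewrite ler_weXn2l// -ltnS.
have T2 : complex.Re (E`_m.+1 * (r%:C * v) ^+ m.+1) <= - (ka / 2) * r ^+ m.+1.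
  have -> : E`_m.+1 = lead_coef E by rewrite lead_coefE mE.
  rewrite exprMn -rmorphXn/= mulrCA.
  have -> x z : complex.Re (x%:C * z) = x * complex.Re z :> R.
    by case: z => z1 z2 /=; rewrite mul0r subr0.
  rewrite [X in _ <= X]mulrC ler_wpM2l ?(le_trans ler01)//.
  have /Hd : cmod (v - u) < d by exact: lt_le_trans vu ed.
  move=> /(le_lt_trans (ger_Re_cmod _))/(le_lt_trans (ler_norm _)).
  rewrite raddfB/= -[complex.Re (lead_coef E * u ^+ m.+1)]opprK -/ka; move: (complex.Re _).
  by clear => x; lra.
have := rm m; have e1 : e * r <= ka / 4 * r by rewrite ler_wpM2r//; lra.
rewrite [r ^+ m.+1]exprS in T2; move: T1 T2 e1 r4 ka0 r1.
move: (complex.Re _) (complex.Re _) (r ^+ m) => x y p; clearbody ka S; clear.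
move=> T1 T2 e1 r4 ka0 r1 p1.
have : S * p <= ka * r / 4 * p by rewrite ler_wpM2r//; lra.
have : ka * r / 4 <= ka * r / 4 * p by rewrite ler_peMr// divr_ge0// mulr_ge0//; lra.
lra.
Qed.

(** Parametrize the circle by u = (1 + i t)^2 / (1 + t^2), t real.  Up to a
    positive factor, Re (lead_coef D * u ^ deg D) is the value at t of a
    polynomial T D, which is nonzero because it does not vanish at t = i.
    Finitely many such polynomials have a common non-root among the natural
    numbers. *)
Lemma exists_direction (s : seq {poly R[i]}) : (forall D, D \in s -> (1 < size D)%N) ->
  exists2 u : R[i], cmod u = 1 & forall D, D \in s ->
    complex.Re (lead_coef D * u ^+ (size D).-1) != 0.
Proof.
move=> hs.
pose T D : {poly R[i]} := lead_coef D *: (1 + 'i *: 'X) ^+ (2 * (size D).-1) +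
   (lead_coef D)^*%C *: (1 - 'i *: 'X) ^+ (2 * (size D).-1).
have TE D (t : R) : (T D).[t%:C] =
    2 * (complex.Re (lead_coef D * (1 + 'i * t%:C) ^+ (2 * (size D).-1)))%:C.
  rewrite -addcJ /T !hornerE; congr (_ + _).
  rewrite rmorphM/= rmorphXn/=; congr (_ * _ ^+ _).
  by apply/eqP; rewrite eq_complex/=; apply/andP; split; apply/eqP; ring.
have T0 D : (1 < size D)%N -> T D != 0.
  move=> sD; apply: contraTneq isT => TD; have : (T D).['i] = 0 by rewrite TD horner0.
  rewrite /T !hornerE.
  have -> : 'i * 'i = -1 :> R[i] by rewrite -expr2 sqr_i.
  rewrite subrr opprK expr0n muln_eq0/=.
  have -> : ((size D).-1 == 0)%N = false by case: (size D) sD => [|[|]].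
  move/eqP; rewrite mulr0 add0r mulf_eq0 conjc_eq0 lead_coef_eq0 expf_eq0.
  rewrite -(natrD _ 1 1) pnatr_eq0 andbF orbF -size_poly_eq0.
  by case: (size D) sD.
pose P := \prod_(D <- s) T D.
have P0 : P != 0.
  rewrite prodf_seq_neq0; apply/allP => D Ds; apply/implyP => _; exact/T0/hs.
have [t Pt] : exists t : R, P.[t%:C] != 0.
  pose rs : seq R[i] := [seq (n%:R : R)%:C | n <- iota 0 (size P)].
  have [/allP all_r|] := boolP (all (root P) rs); last first.
    by rewrite -has_predC => /hasP[_ /mapP[n _ ->] h]; exists n%:R.
  have U : uniq rs.
    rewrite map_inj_uniq ?iota_uniq// => m n /complexI/eqP.
    by rewrite eqr_nat => /eqP.
  have := max_poly_roots P0 (introT allP all_r) U.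
  by rewrite size_map size_iota ltnn.
pose b : R[i] := 1 + 'i * t%:C.
have cb : cmod b ^+ 2 = 1 + t ^+ 2.
  rewrite /cmod /b /= sqr_sqrtr; last by rewrite addr_ge0// sqr_ge0.
  ring.
have t2 : 0 < 1 + t ^+ 2 by rewrite ltr_pwDl// sqr_ge0.
exists (((1 + t ^+ 2)^-1)%:C * b ^+ 2).
  by rewrite cmodM cmodX cb cmodR gtr0_norm ?invr_gt0// mulVf// gt_eqF.
move=> D Ds.
have : (T D).[t%:C] != 0.
  apply: contraNneq Pt; rewrite /P (big_rem D)//= hornerM => ->.
  by rewrite mul0r.
rewrite TE; apply: contraNneq; rewrite exprMn -exprM -rmorphXn/= mulrCA.
have -> x z : complex.Re (x%:C * z) = x * complex.Re z :> R.
  by case: z => z1 z2 /=; rewrite mul0r subr0.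
move/eqP; rewrite mulf_eq0 expf_eq0 invr_eq0 (gt_eqF t2) andbF/= => /eqP ->.
by rewrite mulr0.
Qed.
End Directions.

(** * Borel's theorem *)

Section Borel.
Variables (R : realType) (I : finType).

Lemma uniform_pos (P : I -> R -> Prop) :
  (forall i e e', P i e -> 0 < e' -> e' <= e -> P i e') ->
  (forall i, exists2 e, 0 < e & P i e) -> exists2 e, 0 < e & forall i, P i e.
Proof.
move=> mono ex.
suff [e e0 H] : exists2 e, 0 < e & forall i, i \in enum I -> P i e.
  by exists e => // i; apply: H; rewrite mem_enum.
elim: (enum I) => [|i s [e e0 IH]]; first by exists 1.
have [e' e'0 Pe'] := ex i; exists (Num.min e e'); first by rewrite lt_min e0.
move=> j; rewrite inE => /predU1P[->|/IH js].
  by apply: mono Pe' _ _; rewrite ?lt_min ?e0// ge_min lexx orbT.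
by apply: mono js _ _; rewrite ?lt_min ?e0// ge_min lexx.
Qed.

Lemma eq0_of_expdecay (x C e r0 : R) : 0 < e -> 0 <= x ->
  (forall r, r0 <= r -> x <= C * expR (- e * r)) -> x = 0.
Proof.
move=> e0 x0 H; apply/le_anti; rewrite x0 andbT leNgt; apply/negP => x1.
pose r := `|r0| + 1 + `|C| / (x * e).
have Q0 : 0 <= `|C| / (x * e) by rewrite divr_ge0// mulr_ge0// ltW.
have rr : r0 <= r by have := ler_norm r0; rewrite /r; lra.
have rp : 0 < r by have := normr_ge0 r0; rewrite /r; lra.
have := H r rr; have := expR_ge1Dx (e * r); have E0 := expR_gt0 (e * r).
rewrite mulNr expRN ler_pdivlMr// => h1 h2.
have er : 0 < e * r by rewrite mulr_gt0.
have : x * (e * r) < C.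
  apply: lt_le_trans h2; rewrite ltr_pM2l//; lra.
have -> : x * (e * r) = x * e * (`|r0| + 1) + `|C|.
  by rewrite /r; field; rewrite !gt_eqF.
have : 0 < x * e * (`|r0| + 1) by rewrite !mulr_gt0// ltr_wpDl.
have := ler_norm C; lra.
Qed.

(** The index k is chosen among the H_i that do not vanish identically as the
    one for which Re Q_k is largest far along a generic ray; [arc_bound] then
    applies to H_k at an arbitrary centre a. *)
Theorem borel (H : I -> R[i] -> R[i]) (Q : I -> {poly R[i]}) :
  (forall i z, cdiff (H i) z) -> (forall i, subexp (H i)) ->
  (forall i j, i != j -> (1 < size (Q i - Q j)%R)%N) ->
  (forall z, \sum_i H i z * cexp (Q i).[z] = 0) ->
  forall i z, H i z = 0.
Proof.
move=> dH gH dQ sumH i0 z0; apply/eqP; apply: contraT => Hi0.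
pose J := [pred i | `[< exists z, H i z != 0 >]].
have JN j : j \notin J -> forall z, H j z = 0.
  by move=> /asboolPn nj z; apply/eqP; apply: contraT => h; case: nj; exists z.
have Ji0 : i0 \in J by apply/asboolP; exists z0.
have [u u1 hu] := @exists_direction R
  [seq Q p.1 - Q p.2 | p <- enum [pred p : I * I | p.1 != p.2]]
  ltac:(by move=> D /mapP[p]; rewrite mem_enum => /dQ h ->).
have {}hu i j : i != j -> decays (Q i - Q j) u \/ decays (Q j - Q i) u.
  move=> ij; have := hu (Q i - Q j); rewrite /decays.
  have -> : Q j - Q i = - (Q i - Q j) by rewrite opprB.
  rewrite lead_coefN size_polyN mulNr raddfN/= oppr_lt0 => /(_ _)/lt_total.
  case/(_ _)/orP; [|by left|by right].
  by apply/mapP; exists (i, j); rewrite ?mem_enum.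
have rays a : exists2 e : R, 0 < e & forall i j, i != j -> decays (Q i - Q j) u ->
    forall (v : R[i]) (r : R), cmod v = 1 -> cmod (v - u) < e -> e^-1 <= r ->
    complex.Re (Q i - Q j).[a + r%:C * v] <= - e * r.
  pose P i e := forall j, i != j -> decays (Q i - Q j) u ->
    forall (v : R[i]) (r : R), cmod v = 1 -> cmod (v - u) < e -> e^-1 <= r ->
    complex.Re (Q i - Q j).[a + r%:C * v] <= - e * r.
  have mono (T : Prop) D (e e' : R) : (T -> forall (v : R[i]) (r : R), cmod v = 1 ->
      cmod (v - u) < e -> e^-1 <= r -> complex.Re D.[a + r%:C * v] <= - e * r) ->
    0 < e' -> e' <= e -> T -> forall (v : R[i]) (r : R), cmod v = 1 ->
      cmod (v - u) < e' -> e'^-1 <= r -> complex.Re D.[a + r%:C * v] <= - e' * r.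
    move=> h e'0 e'e t v r v1 vu er; have e0 : 0 < e by exact: lt_le_trans e'e.
    have r0 : 0 < r by apply: lt_le_trans er; rewrite invr_gt0.
    apply: (le_trans (h t v r v1 (lt_le_trans vu e'e) _)).
      by apply: le_trans er; rewrite lef_pV2// posrE.
    by rewrite ler_pM2r// lerN2.
  apply: uniform_pos => [i e e' h e'0 e'e j ij|i].
    exact: mono (h j ij) e'0 e'e.
  apply: uniform_pos => [j e e' h e'0 e'e ij|j].
    exact: mono (h ij) e'0 e'e.
  case: (pselect (i != j /\ decays (Q i - Q j) u)) => [[ij dec]|h]; last first.
    by exists 1 => // ij dec; case: h.
  have [e e0 he] := decays_ray a (dQ i j ij) u1 dec.
  by exists e => // _ _; exact: he.
have [k Jk dom] : exists2 k, k \in J & forall j, j \in J -> j != k -> decays (Q j - Q k) u.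
  have [e e0 He] := rays 0.
  pose val i := complex.Re (Q i).[0 + (e^-1)%:C * u].
  case: (@Order.TotalTheory.arg_maxP _ _ _ i0 (mem J) val Ji0) => k Jk kmax.
  exists k => // j Jj jk; have [//|kj] := hu j k jk.
  have := He k j; rewrite eq_sym => /(_ jk kj u e^-1 u1).
  rewrite subrr cmod0 => /(_ e0 (lexx _)).
  rewrite hornerD hornerN raddfB/= mulNr mulfV ?gt_eqF// => h.
  have : val j <= val k := kmax j Jj.
  by rewrite /val => h'; exfalso; lra.
have /asboolP[a Hka] := Jk; case/negP: Hka; rewrite -cmod_eq0; apply/eqP.
have [e e0 He] := rays a.
have [N HN] := arc_bound e0.
(* the N + 1 factors of size exp (eta r) cost exp (e r / 2), half of the gain *)
pose eta : R := e / (2 * N.+1%:R).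
have N0 : 0 < N.+1%:R :> R by [].
have eta0 : 0 < eta by rewrite divr_gt0// mulr_gt0.
have /boolp.choice[A HA] : forall i, exists A : R,
    0 < A /\ forall z, cmod (H i z) <= A * expR (eta * cmod z).
  by move=> i; have [A A0 h] := gH i eta eta0; exists A.
pose B := \sum_i A i.
have A0 i : 0 <= A i by case: (HA i) => /ltW.
have B0 : 0 <= B by exact: sumr_ge0.
have HB i z : cmod (H i z) <= B * expR (eta * cmod z).
  apply: le_trans ((HA i).2 z) _; rewrite ler_wpM2r ?expR_ge0//.
  by rewrite /B (bigD1 i)//= lerDl sumr_ge0.
have grow i (r : R) (w : R[i]) : 0 <= r -> cmod (w - a) = r ->
    cmod (H i w) <= B * expR (eta * (cmod a + r)).
  move=> r0 wr; apply: le_trans (HB i w) _; rewrite ler_wpM2l// ler_expR ler_wpM2l ?(ltW eta0)//.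
  by rewrite -wr; have {1}-> : w = a + (w - a); [ring|exact: cmodD].
pose M (r : R) := B * expR (eta * (cmod a + r)).
have main (r : R) : e^-1 <= r ->
    cmod (H k a) ^+ N.+1 <= (#|I|%:R * (M r * expR (- e * r))) * M r ^+ N.
  move=> er; have r0 : 0 < r by apply: lt_le_trans er; rewrite invr_gt0.
  have M0 : 0 <= M r by rewrite mulr_ge0// expR_ge0.
  apply: (HN (H k) a u r (M r)) => //.
  - by rewrite mulr_ge0// mulr_ge0// expR_ge0.
  - by move=> w; exact: grow (ltW r0).
  move=> v v1 vu; set w := a + r%:C * v.
  have wr : cmod (w - a) = r.
    by rewrite /w addrAC subrr add0r cmodM v1 mulr1 cmodR gtr0_norm.
  have E : H k w = - \sum_(j | j != k) H j w * cexp (Q j - Q k).[w].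
    apply: (mulIf (cexp_neq0 (Q k).[w])); rewrite mulNr mulr_suml.
    apply/eqP; rewrite -addr_eq0; apply/eqP; rewrite -[RHS](sumH w) [RHS](bigD1 k)//=.
    congr (_ + _); apply: eq_bigr => j _; rewrite -mulrA -cexpD; congr (_ * cexp _).
    by rewrite hornerD hornerN subrK.
  rewrite E cmodN (le_trans (cmod_sum _ _ _))//.
  apply: le_trans (_ : \sum_(j : I) M r * expR (- e * r) <= _); last first.
    by rewrite sumr_const mulr_natl.
  rewrite big_mkcond/=; apply: ler_sum => j _.
  have T0 : 0 <= M r * expR (- e * r) by rewrite mulr_ge0// expR_ge0.
  case: ifP => // jk; have [Jj|/JN ->] := boolP (j \in J); last by rewrite mul0r cmod0.
  rewrite cmodM cmod_cexp ler_pM ?cmod_ge0 ?expR_ge0//; first exact: grow (ltW r0) wr.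
  by rewrite ler_expR; apply: He => //; exact: dom.
apply/eqP; rewrite -(andTb (_ == 0)) -(expf_eq0 _ N.+1); apply/eqP.
apply: (@eq0_of_expdecay _ (#|I|%:R * B ^+ N.+1 * expR (e / 2 * cmod a)) (e / 2) e^-1).
- by rewrite divr_gt0.
- by rewrite exprn_ge0// cmod_ge0.
move=> r /main h; apply: le_trans h _; rewrite le_eqVlt; apply/orP; left; apply/eqP.
have -> : #|I|%:R * (M r * expR (- e * r)) * M r ^+ N = #|I|%:R * expR (- e * r) * M r ^+ N.+1.
  by rewrite exprS; ring.
rewrite /M exprMn -expRM_natl.
have -> : N.+1%:R * (eta * (cmod a + r)) = e / 2 * cmod a + e / 2 * r.
  by rewrite /eta; field; rewrite gt_eqF.
rewrite expRD.
have -> : expR (- e * r) = expR (- (e / 2) * r) * expR (- (e / 2) * r).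
  by rewrite -expRD; congr expR; lra.
have -> : expR (e / 2 * r) = (expR (- (e / 2) * r))^-1 by rewrite -expRN; congr expR; ring.
by field; rewrite gt_eqF// expR_gt0.
Qed.
End Borel.

(** * Relations over functions of order less than one *)

Section LowOrder.
Variable R : realType.
Implicit Types (phi : R[i] -> R[i]) (p : {poly R[i]}).

Lemma ccont_horner p z : ccont (fun w => p.[w]) z.
Proof.
have -> : (fun w => p.[w]) = (fun w => \sum_(i < size p) p`_i * w ^+ i).
  by apply/funext => w; rewrite horner_coef.
by apply: ccont_sum => i _; apply: ccontM; [exact: ccont_cst|apply: ccontX; exact: ccont_id].
Qed.

(** A continuous function with values in the finite set of roots of p is locally
    constant: factor p = (X - f z) ^ m q with q (f z) != 0. *)
Lemma root_ccont_cst p (f : R[i] -> R[i]) z : p != 0 -> ccont f z ->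
  (exists2 d : R, 0 < d & forall w, cmod (w - z) < d -> p.[f w] = 0) ->
  exists2 d : R, 0 < d & forall w, cmod (w - z) < d -> f w = f z.
Proof.
move=> p0 cf [d d0 H].
have [m [q]] := multiplicity_XsubC p (f z); rewrite p0/= => qz pE.
have := ccont_comp cf (@ccont_horner q (f z)).
have q0 : 0 < cmod q.[f z] by rewrite cmod_gt0.
move=> /(_ _ q0)[d' d'0 H']; exists (Num.min d d'); first by rewrite lt_min d0.
move=> w; rewrite lt_min => /andP[/H + /H' h]; rewrite pE hornerM => /eqP.
rewrite mulf_eq0 => /orP[/eqP qw|]; first by rewrite qw sub0r cmodN ltxx in h.
by rewrite horner_exp !hornerE expf_eq0 subr_eq0 => /andP[_ /eqP].
Qed.

(** Exponentials of polynomials with pairwise nonconstant differences are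
    linearly independent over the field C(phi); the coefficients have been
    cleared of denominators. *)
Theorem low_order_coefficients (I : finType) phi (q Q : I -> {poly R[i]}) :
  M_lt1 phi -> mer_nonconstant phi ->
  (forall i j, i != j -> (1 < size (Q i - Q j)%R)%N) ->
  mer_eq (fun z => \sum_i (q i).[phi z] * cexp (Q i).[z]) (fun=> 0) ->
  forall i, q i = 0.
Proof.
move=> [mphi [g [h [og oh [z0 hz0] phiE]]]] nphi dQ E i0.
apply/eqP; apply: contraT => qi0; case: nphi.
have [dg dh] := (O_lt1_cdiff og, O_lt1_cdiff oh).
pose N := (\max_i size (q i))%N.
(* One factor h more than the degree requires: it makes H i vanish where h
   does, where g / h carries no information. *)
pose H i z := h z * \sum_(k < N) (q i)`_k * (g z ^+ k * h z ^+ (N - k)).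
have HE i z : h z != 0 -> H i z = h z ^+ N.+1 * (q i).[g z / h z].
  move=> hz; rewrite /H exprS -mulrA; congr (_ * _).
  rewrite (@horner_coef_wide _ N); last by rewrite /N leq_bigmax.
  rewrite mulr_sumr; apply: eq_bigr => k _; rewrite [RHS]mulrCA; congr (_ * _).
  have -> : h z ^+ N = h z ^+ (N - k) * h z ^+ k by rewrite -exprD subnK// ltnW.
  by rewrite expr_div_n; field; rewrite expf_neq0.
have dH i z : cdiff (H i) z.
  apply: cdiffM => //; apply: cdiff_sum => k; apply: cdiffM; first exact: cdiff_cst.
  by apply: cdiffM; exact: cdiffX.
have gH i : subexp (H i).
  apply: subexpM; first exact: O_lt1_subexp.
  apply: subexp_sum => k; apply: subexpM; first exact: subexp_cst.
  by apply: subexpM; apply: subexpX; exact: O_lt1_subexp.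
have sumH z : \sum_i H i z * cexp (Q i).[z] = 0.
  apply: (@ccont_dnbhs0 _ (fun z => \sum_i H i z * cexp (Q i).[z])).
    apply: ccont_sum => i _; apply: ccontM; first exact/cdiff_cont/dH.
    exact: ccont_comp (@ccont_horner _ z) (cdiff_cont (cdiff_cexp _)).
  have /dnbhsC_P[d1 d10 H1] := E z; have /dnbhsC_P[d2 d20 H2] := phiE z.
  apply/dnbhsC_P; exists (Num.min d1 d2); first by rewrite lt_min d10.
  move=> w wz; rewrite lt_min => /andP[/(H1 _ wz) E1 /(H2 _ wz) E2].
  have [hw|hw] := eqVneq (h w) 0.
    by rewrite big1// => i _; rewrite /H hw !mul0r.
  rewrite E2 in E1; under eq_bigr => i _ do rewrite HE// -mulrA.
  by rewrite -mulr_sumr E1 mulr0.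
have Hi0 := borel dH gH dQ sumH i0.
have ch : ccont h z0 by exact: cdiff_cont.
have h0 : 0 < cmod (h z0) by rewrite cmod_gt0.
have [d d0 hd] := ch _ h0.
have hn0 w : cmod (w - z0) < d -> h w != 0.
  by move=> /hd; apply: contraTneq => ->; rewrite sub0r cmodN ltxx.
have cgh : ccont (fun w => g w / h w) z0.
  by apply: ccontM; [exact: cdiff_cont|exact: ccontV].
have [|d' d'0 H'] := root_ccont_cst qi0 cgh.
  exists d => // w wd; have := Hi0 w; rewrite HE ?hn0// => /eqP.
  by rewrite mulf_eq0 expf_eq0/= (negPf (hn0 _ wd)) => /eqP.
exists (g z0 / h z0); apply: (@meromorphic_identity _ _ _ z0) => //.
have /dnbhsC_P[d2 d20 H2] := phiE z0.
exists (Num.min d' d2); first by rewrite lt_min d'0.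
by move=> w wz; rewrite lt_min => /andP[/H' <- /(H2 _ wz)].
Qed.

Lemma nonconstant_polyP p : nonconstant_poly p <-> (1 < size p)%N.
Proof. by rewrite /nonconstant_poly /pdeg; case: (size p) => [|[|]]. Qed.

(** Among the terms with a nonzero coefficient, the one of largest degree is not
    cancelled. *)
Lemma size_distinct_degrees (r : nat) (P : 'I_r -> {poly R[i]}) (c : 'I_r -> R[i]) :
  (forall j, (1 < size (P j))%N) -> injective (fun j => size (P j)) ->
  (exists j, c j != 0) -> (1 < size (\sum_j c j *: P j)%R)%N.
Proof.
move=> P1 Pinj [j0 cj0].
have [j cj jmax] := @arg_maxnP _ j0 (fun j => c j != 0) (fun j => size (P j)) cj0.
apply: leq_trans (P1 j) _; rewrite leqNgt; apply/negP => sz.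
have : (\sum_j c j *: P j)`_(size (P j)).-1 = 0.
  by rewrite nth_default// -ltnS prednK// (ltnW (P1 j)).
rewrite coef_sum (bigD1 j)//= big1 => [|i ij].
  rewrite addr0 coefZ -lead_coefE => /eqP.
  by rewrite mulf_eq0 (negPf cj) lead_coef_eq0 -size_poly_eq0; case: (size _) (P1 j).
rewrite coefZ; have [->|ci] := eqVneq (c i) 0; first by rewrite mul0r.
rewrite nth_default ?mulr0// -ltnS prednK ?(ltnW (P1 j))//.
rewrite ltn_neqAle (jmax i ci : (_ <= _)%N) andbT.
by apply: contra ij => /eqP/Pinj ->.
Qed.

Lemma cexp_sum (J : Type) (s : seq J) (F : J -> R[i]) :
  cexp (\sum_(j <- s) F j) = \prod_(j <- s) cexp (F j).
Proof. exact: (big_morph _ (@cexpD R) (@cexp0 R)). Qed.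

Lemma cexpX (z : R[i]) n : cexp z ^+ n = cexp (n%:R * z).
Proof.
elim: n => [|n IH]; first by rewrite expr0 mul0r cexp0.
by rewrite exprS IH -cexpD -natr1 mulrDl mul1r addrC.
Qed.
End LowOrder.

(** * Independence of the exponential family *)

Section Family.
Variables (R : realType) (r : nat) (phi : R[i] -> R[i]) (P : 'I_r -> {poly R[i]}).
Hypotheses (hphi : M_lt1 phi) (nphi : mer_nonconstant phi).
Hypothesis (P1 : forall j, (1 < size (P j))%N).

Lemma exp_family0 z : exp_family phi P ord0 z = phi z.
Proof. by rewrite /exp_family unlift_none. Qed.
Lemma exp_family_lift j z : exp_family phi P (lift ord0 j) z = cexp (P j).[z].
Proof. by rewrite /exp_family liftK. Qed.

Lemma exp_family_lin_indep :
  (forall j k, j != k -> (1 < size (P j - P k)%R)%N) ->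
  lin_indep (exp_family phi P).
Proof.
move=> PP c E.
pose q i : {poly R[i]} := if unlift ord0 i is Some j then (c i)%:P else c i *: 'X.
pose Q i : {poly R[i]} := if unlift ord0 i is Some j then P j else 0.
have q0 : forall i, q i = 0.
  apply: (low_order_coefficients (Q := Q) hphi nphi).
    move=> i j; rewrite /Q; case: unliftP => [i'|] ->; case: unliftP => [j'|] ->.
    - by move=> h; apply: PP; apply: contraNneq h => ->.
    - by rewrite subr0.
    - by rewrite sub0r size_polyN.
    - by rewrite eqxx.
  move=> z; have := E z; congr (nbhs _ _); apply/funext => w; congr (_ = _).
  apply: eq_bigr => i _; rewrite /q /Q /exp_family.
  case: unliftP => [j|] _; first by rewrite hornerC.
  by rewrite hornerZ hornerX horner0 cexp0 mulr1.
move=> i; have := q0 i; rewrite /q; case: unliftP => [j|] _.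
  by move/eqP; rewrite polyC_eq0 => /eqP.
by move/eqP; rewrite scaler_eq0 polyX_eq0 orbF => /eqP.
Qed.

(** A monomial of exponent m takes at the family the value
    phi ^ m_0 * exp (sum_j m_(j+1) P_j); the coefficients q t gather the
    monomials that have the same exponential part. *)
Lemma exp_family_alg_indep : injective (fun j => size (P j)) ->
  alg_indep (exp_family phi P).
Proof.
move=> Pinj p E.
set K := msize p.
pose T := {ffun 'I_r -> 'I_K.+1}.
(* the exponents of m are below K, so that [inord] does not truncate them *)
pose tail (m : bmultinom r.+1 K) : T :=
  [ffun j => inord ((m : multinom r.+1) (lift ord0 j))].
have tailE m j : tail m j = (m : multinom r.+1) (lift ord0 j) :> nat.
  rewrite ffunE inordK// ltnS; apply: leq_trans (ltnW (bmdeg m)).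
  by rewrite mdegE (bigD1 (lift ord0 j))//= leq_addr.
pose q (t : T) : {poly R[i]} :=
  \sum_(m | tail m == t) mcoeff m p *: 'X^((m : multinom r.+1) ord0).
pose Q (t : T) : {poly R[i]} := \sum_j (t j)%:R *: P j.
have q0 : forall t, q t = 0.
  apply: (low_order_coefficients (Q := Q) hphi nphi).
    move=> s t st; rewrite /Q -sumrB.
    have -> : \sum_j ((s j)%:R *: P j - (t j)%:R *: P j) =
              \sum_j ((s j)%:R - (t j)%:R) *: P j.
      by apply: eq_bigr => j _; rewrite scalerBl.
    apply: size_distinct_degrees => //.
    apply/existsP; apply: contraNT st; rewrite negb_exists => /forallP h.
    apply/eqP/ffunP => j; apply/val_inj/eqP; rewrite -(eqr_nat R[i]) -subr_eq0.
    by have := h j; rewrite negbK.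
  move=> z; have := E z; congr (nbhs _ _); apply/funext => w; congr (_ = _).
  rewrite {1}(mpolywE (leqnn K)) raddf_sum/= (partition_big tail xpredT)//=.
  apply: eq_bigr => t _; rewrite /q horner_sum mulr_suml; apply: eq_bigr => m /eqP mt.
  rewrite mevalZ mevalX big_ord_recl exp_family0 hornerZ hornerXn -mulrA.
  congr (_ * (_ * _)); rewrite /Q horner_sum cexp_sum; apply: eq_bigr => j _.
  by rewrite exp_family_lift cexpX -mt tailE hornerZ.
rewrite (mpolywE (leqnn K)) big1// => m _; apply/eqP; rewrite scaler_eq0; apply/orP; left.
have := congr1 (fun s : {poly R[i]} => s`_((m : multinom r.+1) ord0)) (q0 (tail m)).
rewrite coef0 /q coef_sum (bigD1 m)//= coefZ coefXn eqxx mulr1 big1 ?addr0; first by move->.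
move=> m' /andP[/eqP mm' nmm']; rewrite coefZ coefXn.
case: eqP => [m0|_]; last by rewrite mulr0.
case/eqP: nmm'; apply/val_inj/mnmP => i.
case: (unliftP ord0 i) => [j|] ->; last by rewrite m0.
by rewrite -!tailE mm'.
Qed.
End Family.

(** * Invertible linear substitutions *)

Section Mix.
Variables (R : realType) (n : nat) (f : 'I_n -> R[i] -> R[i]) (A : 'M[R[i]]_n).
Hypothesis uA : A \in unitmx.

Lemma mix_family_lin_indep : lin_indep f -> lin_indep (mix_family A f).
Proof.
move=> If c E.
have Ac : A *m (\col_j c j) = 0.
  apply/colP => i; rewrite !mxE.
  have := If (fun i => \sum_j A i j * c j); under eq_bigr do rewrite mxE; apply.
  move=> z; have := E z; congr (nbhs _ _); apply/funext => w; congr (_ = _).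
  rewrite /mix_family; under eq_bigr do rewrite mulr_sumr.
  rewrite exchange_big/=; apply: eq_bigr => k _; rewrite mulr_suml.
  by apply: eq_bigr => j _; ring.
move=> j; have : (\col_j c j) j ord0 = 0; last by rewrite mxE.
by rewrite -[\col_j _](mulKmx uA) Ac mulmx0 mxE.
Qed.

Definition linear_forms (B : 'M[R[i]]_n) : n.-tuple (mpoly n R[i]) :=
  [tuple \sum_i B i j *: mpolyX R[i] (mnm1 i) | j < n].

Lemma comp_linear_formsK (B : 'M[R[i]]_n) (p : mpoly n R[i]) : B *m A = 1%:M ->
  comp_mpoly (linear_forms B) (comp_mpoly (linear_forms A) p) = p.
Proof.
move=> BA; rewrite [comp_mpoly (linear_forms A) p]comp_mpolyEX raddf_sum [RHS]mpolyE/=.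
apply: eq_bigr => m _.
rewrite comp_mpolyZ comp_mpolyX rmorph_prod/=; congr (_ *: _).
rewrite [RHS]mpolyXE_id; apply: eq_bigr => j _; rewrite rmorphXn/=; congr (_ ^+ _).
rewrite tnth_mktuple raddf_sum/=.
under eq_bigr => i _ do rewrite comp_mpolyZ comp_mpolyXU -tnth_nth tnth_mktuple scaler_sumr.
rewrite exchange_big/= (bigD1 j)//= [X in _ + X]big1 => [|k kj].
  rewrite addr0; under eq_bigr do rewrite scalerA.
  rewrite -scaler_suml.
  have -> : \sum_i A i j * B j i = (B *m A) j j.
    by rewrite mxE; apply: eq_bigr => i _; rewrite mulrC.
  by rewrite BA mxE eqxx scale1r.
under eq_bigr do rewrite scalerA.
rewrite -scaler_suml.
have -> : \sum_i A i j * B k i = (B *m A) k j.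
  by rewrite mxE; apply: eq_bigr => i _; rewrite mulrC.
by rewrite BA mxE (negPf kj) scale0r.
Qed.

Lemma mix_family_alg_indep : alg_indep f -> alg_indep (mix_family A f).
Proof.
move=> If p E.
rewrite -(comp_linear_formsK p (mulVmx uA)) (If (comp_mpoly (linear_forms A) p)) ?raddf0//.
move=> z; have := E z; congr (nbhs _ _); apply/funext => w; congr (_ = _).
rewrite comp_mpoly_meval; apply: meval_eq => j.
rewrite tnth_mktuple raddf_sum/=; apply: eq_bigr => i _.
by rewrite mevalZ mevalXU.
Qed.
End Mix.

Theorem corollary3p5 (R : realType) (r : nat) (phi : R[i] -> R[i])
    (P : 'I_r -> {poly R[i]}) :
  (1 <= r)%N ->
  M_lt1 phi ->
  mer_nonconstant phi ->
  (forall j, nonconstant_poly (P j)) ->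
  (forall j k, j != k -> nonconstant_poly (P j - P k)) ->
  [/\ lin_indep (exp_family phi P),
      injective (fun j => pdeg (P j)) -> alg_indep (exp_family phi P)
    & forall A : 'M[R[i]]_r.+1, A \in unitmx ->
        lin_indep (mix_family A (exp_family phi P)) /\
        (injective (fun j => pdeg (P j)) ->
           alg_indep (mix_family A (exp_family phi P)))].
Proof.
move=> _ hphi nphi hP hPP.
have P1 j : (1 < size (P j))%N by apply/nonconstant_polyP.
have lin : lin_indep (exp_family phi P).
  by apply: exp_family_lin_indep => // j k jk; apply/nonconstant_polyP/hPP.
have alg : injective (fun j => pdeg (P j)) -> alg_indep (exp_family phi P).
  move=> inj; apply: exp_family_alg_indep => // j k jk; apply: inj.
  by rewrite /pdeg jk.
split=> // A uA; split; first exact: mix_family_lin_indep.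
by move=> /alg; exact: mix_family_alg_indep.
Qed.
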